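(* Let $\alpha\in(0,1)$ and let $\Lambda_\alpha\subset\mathbb{R}$ be a Delone set associated with an $\alpha$-Kakutani tiling of $\mathbb{R}$. Then $\Lambda_\alpha$ is uniformly spread if and only if $$r_\alpha:=\frac{\log(\min\{\alpha,1-\alpha\})}{\log(1-\min\{\alpha,1-\alpha\})}\in\left\{1,\tfrac{3}{2},2,3,4\right\}.$$
   Context: Delone sets. A set $\Lambda\subset\mathbb{R}$ is Delone if it is uniformly discrete and relatively dense, i.e. there are constants $0<r,R<\infty$ such that $B(x,r)\cap\Lambda=\{x\}$ for all $x\in\Lambda$ and $B(y,R)\cap\Lambda\neq\emptyset$ for all $y\in\mathbb{R}$. Two Delone sets $\Lambda,\Gamma\subset\mathbb{R}$ are bounded displacement (BD) equivalent if there is a bijection $\varphi:\Lambda\to\Gamma$ with $\sup_{x\in\Lambda}|x-\varphi(x)|<\infty$. A Delone set $\Lambda\subset\mathbb{R}$ is uniformly spread if it is BD equivalent to some lattice in $\mathbb{R}$, i.e. to $c\mathbb{Z}$ for some $c>0$. Patches and tilings. A tile is a closed bounded interval of positive length. A patch is a finite collection of tiles with pairwise disjoint interiors whose union is an interval; a tiling of $\mathbb{R}$ is a collection of tiles with pairwise disjoint interiors whose union is $\mathbb{R}$ (a patch of a tiling is a patch contained in it; a sub-patch of a patch is a patch contained in it). Patches and tilings are identified with the closed set of the endpoints of their tiles. $\alpha$-Kakutani generating patches. Fix $\alpha\in(0,1)$. Substituting a tile $[a,a+s]$ means replacing it by the two tiles $[a,a+\alpha s]$ and $[a+\alpha s,a+s]$.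 For a closed interval $I\subset\mathbb{R}$ of unit length with the origin in its interior and $t\ge 0$, let $F_t(I)$ be the patch obtained from the single tile $e^tI$ by iteratively substituting every tile of length strictly greater than $1$ until all tiles have length at most $1$. Let $\mathcal{P}_\alpha=\{F_t(I) : t\ge 0,\ I \text{ a closed unit interval with the origin in its interior}\}$. Chabauty–Fell metric. For closed sets $A_0,A_1\subset\mathbb{R}$, $D(A_0,A_1)$ is the infimum of all $0<\varepsilon<1$ such that $A_i\cap(-1/\varepsilon,1/\varepsilon)$ is contained in the $\varepsilon$-neighbourhood of $A_{1-i}$ for both $i=0,1$, and $D(A_0,A_1)=1$ if there is no such $\varepsilon$. An $\alpha$-Kakutani tiling is a tiling of $\mathbb{R}$ whose every patch is a limit, with respect to $D$, of translated sub-patches of elements of $\mathcal{P}_\alpha$. (Its tiles have lengths between $\min\{\alpha,1-\alpha\}$ and $1$.) A Delone set associated with such a tiling is a set obtained by selecting one point from each tile, such that distinct tiles yield distinct points and the resulting set is uniformly discrete. *)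

(* Defs.v *)
From HB Require Import structures.
From mathcomp Require Import all_boot all_order all_algebra.
From mathcomp Require Import all_classical all_reals all_analysis.

Set Implicit Arguments.
Unset Strict Implicit.
Unset Printing Implicit Defensive.

Import Order.TTheory GRing.Theory Num.Theory.
Import numFieldNormedType.Exports.

Local Open Scope classical_set_scope.
Local Open Scope ring_scope.

Section Delone.
Context {R : realType}.
Implicit Types L G : set R.

Definition uniformly_discrete L :=
  exists2 r : R, 0 < r & forall x, L x -> ball x r `&` L = [set x].

Definition relatively_dense L :=
  exists2 r : R, 0 < r & forall y : R, ball y r `&` L !=set0.

Definition delone L := uniformly_discrete L /\ relatively_dense L.

Definition bd_equivalent L G :=
  exists2 phi : R -> R, set_bij L G phi &
    @has_ubound _ R [set `|x - phi x| | x in L].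

Definition lattice (c : R) : set R := [set c * k%:~R | k in [set: int]].

Definition uniformly_spread L :=
  delone L /\ exists2 c : R, 0 < c & bd_equivalent L (lattice c).

End Delone.

Section Tilings.
Context {R : realType}.
Implicit Types (T : R * R) (P Q tau : set (R * R)).

(* The tile [a, b] is encoded by the pair (a, b) of its endpoints. *)
Definition is_tile T := T.1 < T.2.

Definition tile_support T : set R := `[T.1, T.2].

Definition tile_length T : R := T.2 - T.1.

Definition tile_collection P :=
  P `<=` is_tile /\ trivIset P (fun T => (tile_support T)°).

Definition is_patch P :=
  [/\ finite_set P, tile_collection P &
      is_interval (\bigcup_(T in P) tile_support T)].

Definition is_tiling tau :=
  tile_collection tau /\ \bigcup_(T in tau) tile_support T = [set: R].

(* A patch of a tiling, or a sub-patch of a patch. *)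
Definition patch_of Q P := is_patch Q /\ Q `<=` P.

Definition endpoints P : set R := fst @` P `|` snd @` P.

Definition translate (v : R) P := [set (T.1 + v, T.2 + v) | T in P].

End Tilings.

Section ChabautyFell.
Context {R : realType}.
Implicit Types A B : set R.

Definition neighbourhood (e : R) A : set R := \bigcup_(a in A) ball a e.

Definition cf_close A B : set R :=
  [set e | [/\ 0 < e < 1,
    A `&` `]- e^-1, e^-1[ `<=` neighbourhood e B &
    B `&` `]- e^-1, e^-1[ `<=` neighbourhood e A]].

Definition cf_dist A B : R :=
  if `[< cf_close A B !=set0 >] then inf (cf_close A B) else 1.

End ChabautyFell.

Section Kakutani.
Context {R : realType}.
Variable alpha : R.
Implicit Types (T : R * R) (P Q tau : set (R * R)).

Definition substitute T : set (R * R) :=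
  let m := T.1 + alpha * tile_length T in [set (T.1, m); (m, T.2)].

Definition substitute_long P : set (R * R) :=
  \bigcup_(T in P) if 1 < tile_length T then substitute T else [set T].

(* P is F_t(I) for I = [a, a + 1]. The patch is unique: once all tiles have
   length at most 1, substitute_long acts as the identity. *)
Definition is_kakutani_patch (t a : R) P :=
  exists2 n, P = iter n substitute_long [set (expR t * a, expR t * (a + 1))] &
    forall T, P T -> tile_length T <= 1.

Definition generating_patches : set (set (R * R)) :=
  [set P | exists t a : R,
    [/\ 0 <= t, a < 0 < a + 1 & is_kakutani_patch t a P]].

Definition translated_subpatches : set (set (R * R)) :=
  [set Q | exists P S (v : R),
    [/\ generating_patches P, patch_of S P & Q = translate v S]].

Definition is_limit_of_subpatches P :=
  exists2 Q : nat -> set (R * R), (forall n, translated_subpatches (Q n)) &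
    cf_dist (endpoints (Q n)) (endpoints P) @[n --> \oo] --> (0 : R).

Definition kakutani_tiling tau :=
  is_tiling tau /\ forall P, patch_of P tau -> is_limit_of_subpatches P.

End Kakutani.

Definition associated_with {R : realType} (tau : set (R * R)) (L : set R) :=
  exists p : R * R -> R,
    [/\ forall T, tau T -> tile_support T (p T), set_inj tau p,
        L = p @` tau & uniformly_discrete L].

Definition log_ratio {R : realType} (alpha : R) : R :=
  ln (Num.min alpha (1 - alpha)) / ln (1 - Num.min alpha (1 - alpha)).

(* Main.v *)
(* Cutting a long supertile down to tiles of length at most 1 produces a number
  of
   tiles N(s) that depends only on its length s, and a Kakutani tiling is
   uniformly spread iff, for one density c, the number of tiles of every finite
   chain stays within a bounded distance of c times its length.  Passing to
   limits, this is equivalent to the same property for long subdivided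
     intervals.

   If log alpha and log (1 - alpha) are incommensurable, the lengths of the
   subtiles are dense while N has arbitrarily large jumps, so the deviation is
   unbounded.  Otherwise alpha = x^p and 1 - alpha = x^q with p and q coprime,
     and
   the numbers a_k of tiles satisfy a_k = a_(k-p) + a_(k-q).  A root z of
   z^p + z^q = 1 with |z| < 1 other than x makes the deviations grow;
     such a root
   exists when p + q > 6, because in the triangle with sides 1, |z|^p, |z|^q the
   angles phi, psi have to satisfy q phi + p psi = 2 pi, which is solved by the
   intermediate value theorem.  When p + q = 6 the root lies on the unit circle:
   deviations of single supertiles are bounded, but unions of supertiles
   accumulate them.  In the remaining cases p + q <= 5 the deviations decay
   geometrically, hence are summable along every path of the subdivision tree.
     *)
Require Import Defs.
From mathcomp Require Import all_boot all_order all_algebra.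
From mathcomp Require Import ring lra zify.
From mathcomp Require Import all_classical all_reals all_analysis.

Set Implicit Arguments.
Unset Strict Implicit.
Unset Printing Implicit Defensive.

Import Order.TTheory GRing.Theory Num.Theory.
Import numFieldNormedType.Exports.
Local Open Scope classical_set_scope.
Local Open Scope ring_scope.

(** * Roots of trinomials in the unit disc *)

(** That a root [z] inside the unit disc forces growth is not read off an explicit solution of the
    recurrence. The sequence [zeta k = Im (z ^+ k * exp (- i th))] solves the reversed recurrence
    [zeta k = zeta (k + p) + zeta (k + q)], and its pairing with the counts over a sliding window is
    conserved. Bounded deviations and [zeta] tending to 0 would make the conserved number 0, which
    it is not. A 6-periodic [zeta] serves in the same way when [p + q = 6]. The density is the
    delicate parameter. All lengths [sigma * x ^- k] with [sigma] in [(x, 1]] give the same count,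
    so the density [C / sigma] of a subdivided interval varies with its length. Positive results
    therefore allow one density per interval and per window before a common one is extracted;
    negative results eliminate the density by combining levels of one interval. A chain of the
    tiling approximates a run of consecutive tiles, not a full supertile; a full supertile of
    comparable length has to be found inside the run. *)

Section Triangle.
Variable R : realType.
Implicit Types (phi psi x y : R) (p q : nat).

Lemma sin_lt_sin y x : 0 < y -> y < x -> x + y < pi -> sin y < sin x.
Proof.
move=> y0 yx xy; rewrite -subr_gt0.
have -> : sin x - sin y = 2 * (cos ((x + y) / 2) * sin ((x - y) / 2)).
  rewrite -[in sin x](_ : (x + y) / 2 + (x - y) / 2 = x); last by field.
  rewrite -[in sin y](_ : (x + y) / 2 - (x - y) / 2 = y); last by field.
  by rewrite sinD sinB; ring.
have pi0 := pi_gt0 R.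
rewrite !mulr_gt0//.
- by apply: cos_gt0_pihalf; apply/andP; split; lra.
- by apply: sin_gt0_pi; apply/andP; split; lra.
Qed.

Lemma sin_cos_D2pin x n :
  sin (x + pi *+ 2 *+ n) = sin x /\ cos (x + pi *+ 2 *+ n) = cos x.
Proof.
split; first exact: (periodicn (@sinD2pi R)).
exact: (periodicn (@cosD2pi R)).
Qed.

(** Bezout provides one angle whose [p]-fold and [q]-fold multiples are [phi] and [- psi] up to
    multiples of [t]. With [t = pi *+ 2], two sides of the triangle become powers of a single
    complex number. *)
Lemma common_argument p q u v phi psi t : (u * p = v * q + 1)%N ->
  q%:R * phi + p%:R * psi = t ->
  (phi *+ u + psi *+ v) *+ p = phi + t *+ v /\
  (phi *+ u + psi *+ v) *+ q = - psi + t *+ u.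
Proof.
move=> uv <-.
rewrite -!(mulr_natl phi) -!(mulr_natl psi) -!(mulr_natl (_ + _)).
have e : u%:R * p%:R = v%:R * q%:R + 1 :> R by rewrite -!natrM uv natrD.
split.
  by rewrite mulrDr !mulrA [p%:R * u%:R]mulrC e; ring.
apply/eqP; rewrite -subr_eq0; apply/eqP.
transitivity (psi * (v%:R * q%:R + 1 - u%:R * p%:R)); first by ring.
by rewrite e subrr mulr0.
Qed.

(* The triangle with angles [phi], [psi] at the ends of its unit side has the
   other sides [rho ^+ q], [rho ^+ p], so [z = rho * exp (i th)] satisfies
   [z ^+ p = rho ^+ p * exp (i phi)] and [z ^+ q = rho ^+ q * exp (- i psi)]. *)
Lemma trinomial_root_of_triangle p q phi psi : (0 < q < p)%N -> coprime p q ->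
  0 < phi -> 0 < psi -> phi + psi < pi -> q%:R * phi + p%:R * psi = pi *+ 2 ->
  sin psi ^+ q * sin (phi + psi) ^+ (p - q) = sin phi ^+ p ->
  sin phi < sin (phi + psi) ->
  exists rho th : R, [/\ 0 < rho < 1, sin th != 0,
    rho ^+ p * cos (th *+ p) + rho ^+ q * cos (th *+ q) = 1 &
    rho ^+ p * sin (th *+ p) + rho ^+ q * sin (th *+ q) = 0].
Proof.
move=> /andP[q0 qp] copq phi0 psi0 ltpi sum2pi eqH ltS.
have p0 : (0 < p)%N := ltn_trans q0 qp.
have S0 : 0 < sin (phi + psi) by apply: sin_gt0_pi; apply/andP; split; lra.
have sphi0 : 0 < sin phi by apply: sin_gt0_pi; apply/andP; split; lra.
have spsi0 : 0 < sin psi by apply: sin_gt0_pi; apply/andP; split; lra.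
set S := sin (phi + psi) in eqH ltS S0.
(* Law of sines for a unit side opposite the angle [pi - phi - psi]. The equation between sines says
   [P ^+ q = Q ^+ p], so one [rho] yields both sides, and [Q < 1] gives [rho < 1]. *)
set Q := sin phi / S; set P := sin psi / S.
have Q0 : 0 < Q by rewrite divr_gt0.
have P0 : 0 < P by rewrite divr_gt0.
have Q1 : Q < 1 by rewrite ltr_pdivrMr ?mul1r.
have PQ : P ^+ q = Q ^+ p.
  rewrite /P /Q !expr_div_n -eqH -{2}(subnK (ltnW qp)) exprD.
  by rewrite [in RHS]mulrC mulrA invfM -mulrA mulrC; field;
     rewrite ?expf_neq0 ?gt_eqF.
set rho := Q `^ (q%:R^-1).
have rho0 : 0 < rho by rewrite powR_gt0.
have rhoq : rho ^+ q = Q.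
  rewrite -powR_mulrn ?ltW// -powRrM mulVf ?powRr1 ?ltW//.
  by rewrite pnatr_eq0 -lt0n.
have rhop : rho ^+ p = P.
  apply/eqP; rewrite -(@eqrXn2 _ q)// ?exprn_ge0 ?ltW//.
  by rewrite PQ -exprM mulnC exprM rhoq.
have rho1 : rho < 1 by rewrite -(@expr_lt1 _ q) ?ltW// rhoq.
have [u v uv _] := egcdnP q p0.
rewrite (eqP copq) in uv.
have [thp thq] := common_argument uv sum2pi.
have [sp cp] := sin_cos_D2pin phi v.
have [sq cq] := sin_cos_D2pin (- psi) u.
have SE : S = sin phi * cos psi + cos phi * sin psi by rewrite /S sinD.
set th := phi *+ u + psi *+ v in thp thq *.
exists rho, th; split.
- by rewrite rho0.
- apply/eqP => th0.
  have H n : sin (th *+ n) = 0.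
    elim: n => [|n IH]; first by rewrite mulr0n sin0.
    by rewrite mulrS sinD IH th0; ring.
  by have := H p; rewrite thp sp => s0; rewrite s0 ltxx in sphi0.
- rewrite thp thq cp cq cosN rhop rhoq /P /Q SE; field.
  by rewrite -SE gt_eqF.
- rewrite thp thq sp sq sinN rhop rhoq /P /Q; field.
  by rewrite gt_eqF.
Qed.

Lemma trinomial_root p q : (0 < q < p)%N -> coprime p q -> (6 < p + q)%N ->
  exists rho th : R, [/\ 0 < rho < 1, sin th != 0,
    rho ^+ p * cos (th *+ p) + rho ^+ q * cos (th *+ q) = 1 &
    rho ^+ p * sin (th *+ p) + rho ^+ q * sin (th *+ q) = 0].
Proof.
move=> /andP[q0 qp] copq pq6.
have p0 : (0 < p)%N := ltn_trans q0 qp.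
have pi0 := pi_gt0 R.
have Q0 : 0 < q%:R :> R by rewrite ltr0n.
have Q1 : 1 <= q%:R :> R by rewrite ler1n.
have QP : q%:R + 1 <= p%:R :> R by rewrite natr1 ler_nat.
have P0 : 0 < p%:R :> R by rewrite ltr0n.
have PQ6 : 7 <= p%:R + q%:R :> R by rewrite -natrD ler_nat.
pose ps (x : R) : R := (pi *+ 2 - q%:R * x) / p%:R.
have psE x : q%:R * x + p%:R * ps x = pi *+ 2.
  by rewrite /ps mulrC; field; rewrite gt_eqF.
pose H (x : R) := sin (ps x) ^+ q * sin (x + ps x) ^+ (p - q) - sin x ^+ p.
have Hc : continuous H.
  have psc : continuous ps.
    move=> x; apply: cvgM; last exact: cvg_cst.
    by apply: cvgB; [exact: cvg_cst|apply: cvgM;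
      [exact: cvg_cst|exact: cvg_id]].
  move=> x; apply: cvgB.
    apply: cvgM.
      apply: (@continuous_comp _ _ _ (fun y => sin (ps y)) (fun z => z ^+ q)).
        by apply: continuous_comp; [exact: psc|exact: continuous_sin].
      exact: exprn_continuous.
    apply: (@continuous_comp _ _ _ (fun y => sin (y + ps y))
                                   (fun z => z ^+ (p - q))).
      apply: (@continuous_comp _ _ _ (fun y => y + ps y) sin).
        by apply: cvgD; [exact: cvg_id|exact: psc].
      exact: continuous_sin.
    exact: exprn_continuous.
  apply: (@continuous_comp _ _ _ sin (fun z => z ^+ p)).
    exact: continuous_sin.
  exact: exprn_continuous.
(* Equal angles [phi = psi]: here [0 < H] reduces to [sin phi0 < sin (2 * phi0)], that is
   [phi0 *+ 3 < pi], which is [6 < p + q]. *)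
pose phi0 : R := pi *+ 2 / (p%:R + q%:R).
have phi00 : 0 < phi0 by rewrite divr_gt0//; lra.
have ps0 : ps phi0 = phi0 by rewrite /ps /phi0; field; apply/andP; split; lra.
have phi0E : (p%:R + q%:R) * phi0 = pi *+ 2 by rewrite /phi0; field; lra.
have phi03 : phi0 *+ 3 < pi by nra.
have sphi0 : 0 < sin phi0 by apply: sin_gt0_pi; apply/andP; split; lra.
have H0 : 0 < H phi0.
  rewrite /H ps0 subr_gt0 -{1}(subnKC (ltnW qp)) exprD ltr_pM2l ?exprn_gt0//.
  rewrite ltrXn2r ?subn_eq0 -?ltnNge//.
  - exact: ltW.
  - by apply: sin_lt_sin; lra.
(* For [4 <= q] the degenerate triangle with [psi = 0] serves as the other end. For [q <= 3] it is
   the isosceles one with [2 * phi + psi = pi], where [sin (phi + psi) = sin phi] and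
   [sin psi < sin phi]; it lies beyond [phi0] because [6 < p + q]. *)
have [phi1 [phi01 ps1 sum1 H1]] : exists phi1, [/\ phi0 < phi1, 0 <= ps phi1,
    phi1 + ps phi1 < pi & H phi1 < 0].
  have [q4|q3] := leqP 4 q.
    have q4' : 4 <= q%:R :> R by rewrite ler_nat.
    have ps0' : ps (pi *+ 2 / q%:R) = 0.
      by rewrite /ps; field; apply/andP; split; lra.
    have qE : q%:R * (pi *+ 2 / q%:R) = pi *+ 2 :> R by field; lra.
    have t0 : 0 < pi *+ 2 / q%:R :> R by rewrite divr_gt0//; lra.
    exists (pi *+ 2 / q%:R); rewrite ps0' addr0; split => //.
    - by rewrite ltr_pM2l ?ltf_pV2 ?posrE; lra.
    - by nra.
    - rewrite /H ps0' sin0 expr0n gtn_eqF// mul0r sub0r oppr_lt0 exprn_gt0//.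
      by apply: sin_gt0_pi; apply/andP; split=> //; nra.
  have q3' : q%:R <= 3 :> R by rewrite ler_nat.
  have d0 : 0 < 2 * p%:R - q%:R :> R by lra.
  pose phi1 : R := (p%:R - 2) * pi / (2 * p%:R - q%:R).
  have ps1E : ps phi1 = (4 - q%:R) * pi / (2 * p%:R - q%:R).
    by rewrite /ps /phi1; field; apply/andP; split; lra.
  have e1 : 2 * phi1 + ps phi1 = pi.
    by rewrite ps1E /phi1; field; lra.
  have phi10 : 0 < phi1 by rewrite divr_gt0// mulr_gt0//; lra.
  have ps10 : 0 < ps phi1 by rewrite ps1E divr_gt0// mulr_gt0//; lra.
  have lt1 : ps phi1 < phi1.
    rewrite ps1E /phi1 ltr_pM2r ?invr_gt0// ltr_pM2r//; lra.
  exists phi1; split.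
  - rewrite -subr_gt0 (_ : phi1 - phi0 = pi * p%:R * (p%:R + q%:R - 6) /
        ((2 * p%:R - q%:R) * (p%:R + q%:R))).
      rewrite divr_gt0 ?mulr_gt0//; lra.
    by rewrite /phi1 /phi0; field; apply/andP; split; lra.
  - exact: ltW.
  - by lra.
  - rewrite /H subr_lt0 (_ : phi1 + ps phi1 = pi - phi1); last by lra.
    rewrite addrC sinDpi sinN opprK.
    rewrite -{2}(subnKC (ltnW qp)) exprD ltr_pM2r; last first.
      by rewrite exprn_gt0// sin_gt0_pi//; apply/andP; split; lra.
    rewrite ltrXn2r -?lt0n//.
      by apply/ltW/sin_gt0_pi; apply/andP; split; lra.
    by apply: sin_lt_sin; lra.
have [||phi] := @IVT R H phi0 phi1 0 (ltW phi01).
- exact: continuous_subspaceT.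
- by rewrite ge_min le_max (ltW H0) (ltW H1) orbT.
rewrite in_itv/= => /andP[le0 le1] Hphi.
have lt1 : phi < phi1.
  by rewrite lt_neqAle le1 andbT; apply: contraTneq H1 => <-; rewrite Hphi ltxx.
have lt0 : phi0 < phi.
  by rewrite lt_neqAle le0 andbT; apply: contraTneq H0 => ->; rewrite Hphi ltxx.
have Eps := psE phi; have Eps1 := psE phi1.
(* As [q < p], the angle [psi] falls more slowly than [phi] grows, so [phi + psi] is at most its
   value at [phi1], hence below [pi]. *)
have dps : p%:R * (ps phi - ps phi1) = q%:R * (phi1 - phi) by lra.
have dps0 : 0 < ps phi - ps phi1 by rewrite -(pmulr_rgt0 _ P0) dps mulr_gt0//;
  lra.
have dps1 : ps phi - ps phi1 <= phi1 - phi.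
  rewrite -(ler_pM2l P0) dps ler_pM2r; lra.
have psphi : ps phi < phi.
  have : (p%:R + q%:R) * phi0 < (p%:R + q%:R) * phi by rewrite ltr_pM2l; lra.
  by rewrite phi0E => ?; nra.
have eqH : sin (ps phi) ^+ q * sin (phi + ps phi) ^+ (p - q) = sin phi ^+ p.
  by apply/eqP; rewrite -subr_eq0 -/(H phi) Hphi.
apply: (@trinomial_root_of_triangle p q phi (ps phi)) => //.
- by rewrite q0.
- by lra.
- by lra.
- by lra.
- have sphi : 0 < sin phi by apply: sin_gt0_pi; apply/andP; split; lra.
  have spsi : 0 < sin (ps phi) by apply: sin_gt0_pi; apply/andP; split; lra.
  rewrite ltNge; apply/negP => leS.
  have ltp : sin (ps phi) < sin phi by apply: sin_lt_sin; lra.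
  move: eqH; rewrite -[in RHS](subnKC (ltnW qp)) exprD => /eqP; apply/negP.
  rewrite lt_eqF//; apply: (@lt_le_trans _ _ (sin phi ^+ q * sin (phi + ps phi)
    ^+ (p - q))).
    rewrite ltr_pM2r ?exprn_gt0//; last by apply: sin_gt0_pi; apply/andP;
      split; lra.
    by rewrite ltrXn2r -?lt0n// ltW.
  rewrite ler_pM2l ?exprn_gt0// lerXn2r ?nnegrE// ltW//.
  by apply: sin_gt0_pi; apply/andP; split; lra.
Qed.
End Triangle.

(** * The numbers of tiles of supertiles *)

(** [n] is fuel. Truncated subtraction sends every negative level to 0, the level of an interval
    that is not cut and counts as one tile. *)
Fixpoint level_count_rec (p q n k : nat) : nat :=
  if n is n'.+1 then
    if k is 0 then 1 else
      level_count_rec p q n' (k - p) + level_count_rec p q n' (k - q)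
  else 1.

Definition level_count p q k := level_count_rec p q k k.

Lemma level_count_recE p q n k : (0 < p)%N -> (0 < q)%N -> (k <= n)%N ->
  level_count_rec p q n k = level_count p q k.
Proof.
move=> p0 q0; have H : forall m n k, (k <= m)%N -> (k <= n)%N ->
    level_count_rec p q n k = level_count_rec p q m k.
  elim=> [|m IH] [|n'] [|k']//= km kn; congr addn; apply: IH; lia.
by move=> kn; apply: H.
Qed.

Lemma level_count0 p q : level_count p q 0 = 1%N. Proof. by []. Qed.

Lemma level_countE p q k : (0 < p)%N -> (0 < q)%N -> (0 < k)%N ->
  level_count p q k = (level_count p q (k - p) + level_count p q (k - q))%N.
Proof.
move=> p0 q0; case: k => // k _.
by rewrite {1}/level_count /= !level_count_recE//; lia.
Qed.

Lemma level_countC p q k : (0 < p)%N -> (0 < q)%N ->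
  level_count p q k = level_count q p k.
Proof.
move=> p0 q0; elim/ltn_ind: k => -[|k] IH; first by rewrite !level_count0.
by rewrite [LHS]level_countE// [RHS]level_countE// addnC; congr addn;
  apply: IH; lia.
Qed.

(** * Geometric decay of the deviations for the five admissible pairs *)

Section Decay.
Variable R : realType.
Implicit Types (e : nat -> R) (k : nat).

Definition decaying_deviation (x : R) (a : nat -> nat) :=
  exists C D kappa : R, [/\ 0 < C, 0 <= D, 0 < kappa < 1 &
    forall k, `|(a k)%:R - C * x ^- k| <= D * kappa ^+ k].

(* The form [e k.+1 ^+ 2 + b * e k.+1 * e k + m * e k ^+ 2] is multiplied by [m]
   at each step and is definite when [b ^+ 2 < 4 * m]. *)
Lemma quadratic_decay e (b m : R) : 0 < m -> b ^+ 2 < 4 * m ->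
  (forall k, e k.+2 + b * e k.+1 + m * e k = 0) ->
  exists2 D : R, 0 <= D & forall k, `|e k| <= D * Num.sqrt m ^+ k.
Proof.
move=> m0 bm rec.
pose E k := e k.+1 ^+ 2 + b * e k.+1 * e k + m * e k ^+ 2.
have ES k : E k.+1 = m * E k.
  rewrite /E (_ : e k.+2 = - (b * e k.+1 + m * e k)); first by ring.
  by have := rec k; lra.
have EE k : E k = m ^+ k * E 0%N.
  by elim: k => [|k IH]; rewrite ?expr0 ?mul1r// ES IH exprS mulrA.
pose d := m - b ^+ 2 / 4.
have d0 : 0 < d by rewrite /d; lra.
have Ed k : d * e k ^+ 2 <= E k.
  rewrite -subr_ge0 (_ : _ - _ = (e k.+1 + b * e k / 2) ^+ 2) ?sqr_ge0//.
  by rewrite /d /E; field.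
have E0 : 0 <= E 0%N by apply: le_trans (Ed 0%N);
  rewrite mulr_ge0 ?sqr_ge0// ltW.
exists (Num.sqrt (E 0%N / d)) => [|k]; first exact: sqrtr_ge0.
rewrite -(@ler_pXn2r _ 2)// ?nnegrE ?mulr_ge0 ?sqrtr_ge0 ?exprn_ge0
  ?sqrtr_ge0//.
rewrite exprMn sqr_sqrtr; last by rewrite divr_ge0// ltW.
rewrite -exprM mulnC exprM sqr_sqrtr ?(ltW m0)//.
rewrite real_normK ?num_real// mulrAC ler_pdivlMr// mulrC [leRHS]mulrC -EE.
exact: Ed.
Qed.

Lemma geometric_residual (r : nat -> R) (lam : R) :
  (forall k, r k.+1 = lam * r k) -> forall k, r k = r 0%N * lam ^+ k.
Proof.
move=> rS; elim=> [|k IH]; first by rewrite expr0 mulr1.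
by rewrite rS IH exprS mulrCA.
Qed.

(** The coefficients are those of [(y - x^-1) * (y ^+ 2 + b * y + x)]. The residual [r] of the
    quadratic factor is geometric with ratio [x^-1], and [C] is chosen so that [C * x^-1 ^+ k] has
    the same residual. The difference [e] then obeys the quadratic recurrence, whose roots are
    complex of modulus [Num.sqrt x]. *)
Lemma cubic_deviation (x b : R) (a : nat -> nat) : 0 < x < 1 -> 0 < b ->
  b ^+ 2 < 4 * x ->
  (forall k, (a k.+3)%:R = (x^-1 - b) * (a k.+2)%:R +
                           (x^-1 * b - x) * (a k.+1)%:R + (a k)%:R :> R) ->
  a 0 = 1%N -> decaying_deviation x a.
Proof.
move=> /andP[x0 x1] b0 bx rec a0.
pose r k : R := (a k.+2)%:R + b * (a k.+1)%:R + x * (a k)%:R.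
have rS k : r k.+1 = x^-1 * r k.
  rewrite /r rec; set a2 : R := (a k.+2)%:R; set a1 : R := (a k.+1)%:R.
  by set a3 : R := (a k)%:R; field; rewrite gt_eqF.
have rE := geometric_residual rS.
have d0 : 0 < x^-1 ^+ 2 + b * x^-1 + x.
  by rewrite !addr_gt0 ?mulr_gt0 ?exprn_gt0 ?invr_gt0.
pose C := r 0%N / (x^-1 ^+ 2 + b * x^-1 + x).
have C0 : 0 < C.
  rewrite divr_gt0// /r a0 mulr1 ltr_wpDl// addr_ge0// ?ler0n// mulr_ge0
    ?ler0n//.
  exact: ltW.
pose e k : R := (a k)%:R - C * x^-1 ^+ k.
have erec k : e k.+2 + b * e k.+1 + x * e k = 0.
  transitivity (r k - r 0%N * x^-1 ^+ k); last by rewrite rE subrr.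
  have <- : C * (x^-1 ^+ 2 + b * x^-1 + x) = r 0%N by rewrite divfK// gt_eqF.
  by rewrite /e /r !exprS expr0; ring.
have [D D0 De] := quadratic_decay x0 bx erec.
exists C, D, (Num.sqrt x); split => //.
  rewrite sqrtr_gt0 x0 -(@ltr_pXn2r _ 2)// ?nnegrE ?sqrtr_ge0//.
  by rewrite sqr_sqrtr ?ltW// expr1n.
by move=> k; rewrite -exprVn; exact: De.
Qed.

(** A rate [t] strictly above both [|mu|] and [kap] works: the gap [t - |mu|] pays for the forcing
    term at every step. *)
Lemma contraction_decay e (mu D kap : R) : `|mu| < 1 -> 0 < kap < 1 -> 0 <= D ->
  (forall k, `|e k.+1 - mu * e k| <= D * kap ^+ k) ->
  exists D' kap' : R, [/\ 0 <= D', 0 < kap' < 1 &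
    forall k, `|e k| <= D' * kap' ^+ k].
Proof.
move=> mu1 /andP[k0 k1] D0 De.
pose t := (1 + Num.max `|mu| kap) / 2.
have lmax : Num.max `|mu| kap < 1 by rewrite gt_max mu1.
have mut : `|mu| < t.
  have : `|mu| <= Num.max `|mu| kap by rewrite le_max lexx.
  by rewrite /t; lra.
have kt : kap < t.
  have : kap <= Num.max `|mu| kap by rewrite le_max lexx orbT.
  by rewrite /t; lra.
have t1 : t < 1 by rewrite /t; lra.
have t0 : 0 < t by apply: lt_trans kt.
have tmu : 0 < t - `|mu| by lra.
exists (`|e 0%N| + D / (t - `|mu|)), t; split.
- by rewrite addr_ge0// divr_ge0// ltW.
- by rewrite t0.
elim=> [|k IH]; first by rewrite expr0 mulr1 lerDl divr_ge0// ltW.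
have -> : e k.+1 = (e k.+1 - mu * e k) + mu * e k by ring.
apply: le_trans (ler_normD _ _) _; rewrite normrM.
have h1 : D * kap ^+ k <= D * t ^+ k.
  by rewrite ler_wpM2l// lerXn2r// ?nnegrE; exact: ltW.
set F := _ + _ in IH *.
have DF : D <= F * (t - `|mu|).
  rewrite /F mulrDl divfK ?gt_eqF// lerDr mulr_ge0// ltW//.
have h2 : D * t ^+ k <= F * (t - `|mu|) * t ^+ k.
  by rewrite ler_wpM2r// exprn_ge0// ltW.
have h3 : `|mu| * `|e k| <= `|mu| * (F * t ^+ k) by rewrite ler_wpM2l.
have := De k; rewrite exprS.
set T := t ^+ k in h1 h2 h3 *; set U := kap ^+ k in h1 *.
set V := `|e k| in h3 *; set W := `|_ - _| => hW.
by apply: le_trans (lerD (le_trans hW (le_trans h1 h2)) h3) _; lra.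
Qed.

Lemma level_count_deviation11 (x : R) : x + x = 1 ->
  decaying_deviation x (level_count 1 1).
Proof.
move=> x1; have x2 : x^-1 = 2 by rewrite (_ : x = 2^-1) ?invrK//; lra.
have aE k : level_count 1 1 k = (2 ^ k)%N.
  elim: k => // k IH; rewrite level_countE// subn1/= IH expnS; lia.
exists 1, 0, (2^-1); split => //; first by apply/andP; split; lra.
by move=> k; rewrite -exprVn x2 aE natrX mul1r subrr normr0 mul0r.
Qed.

Lemma level_count_deviation21 (x : R) : 0 < x < 1 -> x ^+ 2 + x = 1 ->
  decaying_deviation x (level_count 2 1).
Proof.
move=> /andP[x0 x1] xE; set a := level_count 2 1.
have rec k : (a k.+2)%:R = (a k)%:R + (a k.+1)%:R :> R.
  by rewrite /a level_countE// subn2 subn1/= natrD.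
have xV : x^-1 - 1 = x by apply: (mulfI (lt0r_neq0 x0));
  rewrite mulrBr mulfV ?gt_eqF//; lra.
pose r k : R := (a k.+1)%:R + x * (a k)%:R.
have rS k : r k.+1 = x^-1 * r k.
  by rewrite /r rec mulrDr mulKf ?gt_eqF// (_ : x^-1 = x + 1); [ring|lra].
have rE := geometric_residual rS.
have d0 : 0 < x^-1 + x by rewrite addr_gt0 ?invr_gt0.
pose C := r 0%N / (x^-1 + x).
have C0 : 0 < C by rewrite divr_gt0// /r mulr1 ltr_wpDl// ler0n.
pose e k : R := (a k)%:R - C * x^-1 ^+ k.
have erec k : e k.+1 = - (x * e k).
  apply/eqP; rewrite -addr_eq0; apply/eqP.
  transitivity (r k - r 0%N * x^-1 ^+ k); last by rewrite rE subrr.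
  have <- : C * (x^-1 + x) = r 0%N by rewrite divfK// gt_eqF.
  by rewrite /e /r !exprS; ring.
exists C, `|e 0%N|, x; split => //; first by rewrite x0.
move=> k; rewrite -exprVn -/(e k); elim: k => [|k IH]; first by rewrite mulr1.
by rewrite erec normrN normrM (gtr0_norm x0) exprS mulrCA ler_wpM2l// ltW.
Qed.

Lemma level_count_deviation31 (x : R) : 0 < x < 1 -> x ^+ 3 + x = 1 ->
  decaying_deviation x (level_count 3 1).
Proof.
move=> x01 xE; have /andP[x0 x1] := x01.
have xV : x * (x^-1 - 1) = x ^+ 3 by rewrite mulrBr mulfV ?gt_eqF//; lra.
have xV' : x^-1 - 1 = x ^+ 2.
  by apply: (mulfI (lt0r_neq0 x0)); rewrite xV; ring.
apply: (@cubic_deviation _ (x^-1 - 1)) => //.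
- by rewrite xV' exprn_gt0.
- by rewrite xV' -exprM; nra.
move=> k; rewrite level_countE// !subSS !subn0 natrD.
have -> : x^-1 * (x^-1 - 1) = x by rewrite xV' expr2 mulKf ?gt_eqF.
by ring.
Qed.

Lemma level_count_deviation32 (x : R) : 0 < x < 1 -> x ^+ 3 + x ^+ 2 = 1 ->
  decaying_deviation x (level_count 3 2).
Proof.
move=> x01 xE; have /andP[x0 x1] := x01.
have xV : x^-1 = x ^+ 2 + x.
  by apply: (mulfI (lt0r_neq0 x0)); rewrite mulfV ?gt_eqF//; lra.
apply: (@cubic_deviation _ (x^-1)) => //.
- by rewrite invr_gt0.
- by rewrite xV; nra.
move=> k; rewrite level_countE// !subSS !subn0 natrD subrr mul0r.
have -> : x^-1 * x^-1 - x = 1.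
  rewrite xV (_ : (x ^+ 2 + x) * (x ^+ 2 + x) - x = (x ^+ 3 + x ^+ 2 - 1) * (x
    + 1) + 1).
    by rewrite xE; ring.
  by ring.
by ring.
Qed.

(** Besides [lam = x^-1], the quartic [y ^+ 4 - y ^+ 3 - 1] has a real root [mu] in [(-1, -8/10)]
    and two complex roots with product [m < 1]. The sequence [u] strips [mu] off the deviation and
    obeys the quadratic recurrence; [contraction_decay] then puts [mu] back. *)
Lemma level_count_deviation41 (x : R) : 0 < x < 1 -> x ^+ 4 + x = 1 ->
  decaying_deviation x (level_count 4 1).
Proof.
move=> x01 xE; have /andP[x0 x1] := x01; set a := level_count 4 1.
have rec k : (a k.+4)%:R = (a k)%:R + (a k.+3)%:R :> R.
  by rewrite /a level_countE// !subSS !subn0 natrD.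
have x7 : 7 / 10 < x.
  rewrite ltNge; apply/negP => xle.
  have : x ^+ 4 <= (7 / 10) ^+ 4 by rewrite lerXn2r ?nnegrE//; lra.
  by lra.
have x8 : x < 8 / 10.
  rewrite ltNge; apply/negP => xle.
  have : (8 / 10) ^+ 4 <= x ^+ 4 by rewrite lerXn2r ?nnegrE//; lra.
  by lra.
pose f : R -> R := fun y => y ^+ 4 - y ^+ 3 - 1.
have fc : continuous f.
  by move=> y; apply: cvgB; [apply: cvgB; exact: exprn_continuous|exact:
    cvg_cst].
have [|||mu] := @IVT R f (-1) (- (8 / 10)) 0.
- by lra.
- exact: continuous_subspaceT.
- by rewrite ge_min le_max /f; apply/andP; split; apply/orP; [right|left]; lra.
rewrite in_itv/= => /andP[mu1 mu8] fmu.
set lam := x^-1.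
have xlam : x * lam = 1 by rewrite mulfV// gt_eqF.
have lam0 : 0 < lam by rewrite invr_gt0.
have flam : f lam = 0.
  rewrite /f; have -> : lam ^+ 4 - lam ^+ 3 - 1 = lam ^+ 4 * (1 - x - x ^+ 4).
    transitivity (lam ^+ 4 - (x * lam) * lam ^+ 3 - (x * lam) ^+ 4).
      by rewrite xlam; ring.
    by ring.
  by rewrite -xE; ring.
have lam1 : 1 < lam by rewrite invf_gt1.
have lam2 : lam < 10 / 7 by nra.
have lam3 : 10 / 8 < lam by nra.
have mu1' : -1 < mu.
  rewrite lt_neqAle mu1 andbT; apply/eqP => mE.
  by move: fmu; rewrite /f -mE; lra.
(* Division of [f] by [(y - lam) * (y - mu)]: the remainder [al * y + be] vanishes at two distinct
   points, so it is zero, and [be = 0] yields [m * mu = - x]. *)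
pose s := lam + mu - 1; pose m := s * (lam + mu) - lam * mu.
pose al := m * (lam + mu) - lam * mu * s; pose be := -1 - lam * mu * m.
have fE y : f y = (y - lam) * (y - mu) * (y ^+ 2 + s * y + m) + al * y + be.
  by rewrite /f /al /be /m /s; ring.
have e1 : al * lam + be = 0 by rewrite -[RHS]flam fE; ring.
have e2 : al * mu + be = 0 by rewrite -[RHS]fmu fE; ring.
have al0 : al = 0.
  have : al * (lam - mu) = 0 by lra.
  by move=> /eqP; rewrite mulf_eq0 => /orP[/eqP//|/eqP ?]; lra.
have be0 : be = 0 by move: e1; rewrite al0 mul0r add0r.
have mmu : m * mu = - x.
  have := be0; rewrite /be => bb.
  transitivity (x * lam * (m * mu)); first by rewrite xlam mul1r.
  have e3 : lam * mu * m = -1 by lra.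
  have -> : x * lam * (m * mu) = x * (lam * mu * m) by ring.
  by rewrite e3 mulrN1.
have m0 : 0 < m by nra.
have m7 : 7 / 10 < m by nra.
have m1 : m < 1 by nra.
have sb : s ^+ 2 < 4 * m by rewrite /s; nra.
pose h y := (y - mu) * (y ^+ 2 + s * y + m).
have hE y : h y = y ^+ 3 + (lam - 1) * y ^+ 2 + lam * (lam - 1) * y + x.
  rewrite -[x]opprK -mmu.
  by rewrite /h /m /s; ring.
pose d k : R := (a k.+1)%:R - mu * (a k)%:R.
pose g k : R := d k.+2 + s * d k.+1 + m * d k.
have gS k : g k.+1 = lam * g k.
  apply/eqP; rewrite -subr_eq0; apply/eqP.
  transitivity (- (al * (a k.+1)%:R + be * (a k)%:R));
    last by rewrite al0 be0; ring.
  by rewrite /g /d rec /al /be /m /s; ring.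
have gE := geometric_residual gS.
have h0 : 0 < h lam.
  by rewrite hE !addr_gt0 ?mulr_gt0 ?exprn_gt0//; lra.
pose C := g 0%N / h lam.
have C0 : 0 < C.
  rewrite divr_gt0// (_ : g 0%N = (a 3)%:R + (lam - 1) * (a 2)%:R +
    lam * (lam - 1) * (a 1)%:R + x * (a 0)%:R).
    have q1 : 0 <= (lam - 1) * (a 2)%:R by rewrite mulr_ge0 ?ler0n//; lra.
    have q2 : 0 <= lam * (lam - 1) * (a 1)%:R by rewrite !mulr_ge0 ?ler0n//;
      lra.
    have q3 : 0 <= (a 3)%:R :> R by rewrite ler0n.
    have q4 : x * (a 0)%:R = x by rewrite mulr1.
    by rewrite q4; lra.
  by rewrite -[x]opprK -mmu /g /d /m /s; ring.
pose e k : R := (a k)%:R - C * lam ^+ k.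
pose u k : R := e k.+1 - mu * e k.
have urec k : u k.+2 + s * u k.+1 + m * u k = 0.
  transitivity (g k - g 0%N * lam ^+ k); last by rewrite gE subrr.
  have -> : g 0%N = C * h lam by rewrite /C divfK// gt_eqF.
  rewrite /u /e /g /d /h !exprS expr0; set t := lam ^+ k.
  by ring.
have [D D0 De] := quadratic_decay m0 sb urec.
have mu_lt1 : `|mu| < 1 by rewrite ltr_norml; apply/andP; split; lra.
have sm : 0 < Num.sqrt m < 1.
  rewrite sqrtr_gt0 m0 -(@ltr_pXn2r _ 2)// ?nnegrE ?sqrtr_ge0//.
  by rewrite sqr_sqrtr ?ltW// expr1n.
have [D' [k' [D'0 k'01 De']]] := contraction_decay mu_lt1 sm D0 De.
exists C, D', k'; split => // k.
by rewrite -exprVn; exact: De'.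
Qed.
End Decay.

(** * Commensurability *)

Section Commensurability.
Variable R : realType.

(** Multiplicative form of the irrationality of [ln A / ln B]. The exponents are naturals because
    they will count left and right cuts along a path of the subdivision tree. *)
Definition incommensurable (A B : R) := forall d : R, 0 < d ->
  exists m1 n1 m2 n2 : nat,
    1 - d < (A ^+ m1 * B ^+ n1) / (A ^+ m2 * B ^+ n2) < 1.

Lemma expRN_ln (A : R) n : 0 < A -> A ^+ n = expR (- (n%:R * - ln A)).
Proof. by move=> A0; rewrite mulrN opprK expRM_natl lnK. Qed.

(** If quotients of monomials stay away from 1, the additive group generated by [- ln A] and
    [- ln B] has a gap above 0, hence a least positive element [h], and both generators are
    multiples of it. Since [h] is itself an integer combination of them, the multipliers are
    coprime. *)
Lemma commensurability (A B : R) : 0 < A < 1 -> 0 < B < 1 ->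
  incommensurable A B \/
  exists (x : R) (p q : nat), [/\ 0 < x < 1, (0 < p)%N, (0 < q)%N, coprime p q &
    A = x ^+ p /\ B = x ^+ q].
Proof.
move=> /andP[A0 A1] /andP[B0 B1].
have [H|/existsNP[d /not_implyP[d0 nH]]] := pselect (incommensurable A B).
  by left.
right.
set a := - ln A; set b := - ln B.
have a0 : 0 < a by rewrite oppr_gt0 ln_lt0// A0.
have b0 : 0 < b by rewrite oppr_gt0 ln_lt0// B0.
have d1 : d < 1.
  rewrite ltNge; apply/negP => d1; apply: nH; exists 1%N, 0%N, 0%N, 0%N.
  rewrite expr1 !expr0 !mulr1 divr1 A1 andbT; lra.
pose G : set R := [set y | exists i j : int, y = i%:~R * a + j%:~R * b].
have GB y z : G y -> G z -> G (y - z).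
  move=> [i [j ->]] [k [l ->]]; exists (i - k), (j - l).
  by rewrite !intrB; ring.
have GZ (k : int) y : G y -> G (k%:~R * y).
  move=> [i [j ->]]; exists (k * i), (k * j).
  by rewrite !intrM; ring.
have Ga : G a by exists 1, 0; rewrite mul1r mul0r addr0.
have Gb : G b by exists 0, 1; rewrite mul1r mul0r add0r.
set d' := - ln (1 - d).
have d'0 : 0 < d' by rewrite oppr_gt0 ln_lt0//; apply/andP; split; lra.
have gap y : G y -> 0 < y -> d' <= y.
  move=> [i [j yE]] y0; rewrite leNgt; apply/negP => yd; apply: nH.
  have split_int (k : int) : exists m n : nat, k = m%:Z - n%:Z.
    by case: k => n; [exists n, 0%N|exists 0%N, n.+1];
      rewrite ?subr0 ?NegzE ?sub0r.
  have [m1 [m2 iE]] := split_int i; have [n1 [n2 jE]] := split_int j.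
  exists m1, n1, m2, n2.
  have -> : A ^+ m1 * B ^+ n1 / (A ^+ m2 * B ^+ n2) = expR (- y).
    rewrite !(expRN_ln _ A0) !(expRN_ln _ B0) -!expRD -expRN -expRD.
    congr expR; rewrite yE iE jE !intrB !pmulrn -/a -/b; ring.
  apply/andP; split; last by rewrite expR_lt1 oppr_lt0.
  by rewrite -[1 - d]lnK ?posrE; [rewrite ltr_expR; move: yd; rewrite /d';
    lra|lra].
pose P := [set y | G y /\ 0 < y].
have Pinf : has_inf P by split; [exists a|exists 0 => y [_ /ltW]].
(* An element within one gap of the infimum is already the minimum: a smaller [y] in the group would
   make [h - y] a positive element below the gap. *)
have [h [Gh h0] hlt] := inf_adherent d'0 Pinf.
have hmin y : G y -> 0 < y -> h <= y.
  move=> Gy y0; rewrite leNgt; apply/negP => yh.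
  have : d' <= h - y by apply: gap; [exact: GB|lra].
  have : inf P <= y by apply: ge_inf => //; exists 0 => z [_ /ltW].
  by lra.
have divh y : G y -> 0 < y -> exists2 n : nat, (0 < n)%N & y = n%:R * h.
  move=> Gy y0; set k := Num.floor (y / h).
  have k1 : k%:~R <= y / h by exact: floor_le.
  have k2 : y / h < k%:~R + 1 by rewrite -intrD1 floorD1_gt.
  rewrite ler_pdivlMr// in k1; rewrite ltr_pdivrMr// in k2.
  have yE : y = k%:~R * h.
    apply/eqP; rewrite -subr_eq0; apply/negPn/negP => ne.
    have := hmin _ (GB _ _ Gy (GZ k _ Gh)).
    have h1 : 0 < y - k%:~R * h by rewrite lt_neqAle eq_sym ne/= subr_ge0.
    by move=> /(_ h1); lra.
  have k0 : 0 < k.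
    by rewrite -(ltr0z R) -(pmulr_lgt0 _ h0) -yE.
  exists `|k|%N; first by rewrite absz_gt0 gt_eqF.
  by rewrite yE -[in LHS](gtz0_abs k0).
have [p p0 aE] := divh _ Ga a0; have [q q0 bE] := divh _ Gb b0.
exists (expR (- h)), p, q; split => //.
- by rewrite expR_gt0 expR_lt1 oppr_lt0.
- have [i [j hE]] := Gh.
  suff : coprimez p q by [].
  apply/coprimezP; exists (i, j) => /=.
  have : (i * p%:Z + j * q%:Z - 1)%:~R * h = 0.
    rewrite intrB intrD !intrM mulrBl mul1r {2}hE aE bE !pmulrn.
    by ring.
  move/eqP; rewrite mulf_eq0 (gt_eqF h0) orbF intr_eq0 subr_eq0.
  by move/eqP.
- split.
    by rewrite -expRM_natl mulrN -aE opprK lnK.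
  by rewrite -expRM_natl mulrN -bE opprK lnK.
Qed.
End Commensurability.

(** * A conserved pairing of the counts with the reversed recurrence *)

Section Conserved.
Variable R : realType.
Variables (p q : nat) (lam : R) (zeta : nat -> R).
Hypotheses (p0 : (0 < p)%N) (q0 : (0 < q)%N).
Hypothesis zetaE : forall k, zeta k = zeta (k + p)%N + zeta (k + q)%N.

Let a k : R := (level_count p q k)%:R.
(** Differencing turns the constant 1 at nonpositive levels into 0, so [b] obeys the recurrence
    except for a unit impulse at index 1. The second step, to [v], annihilates the dominant solution
    [lam ^+ k] and with it the unknown density. *)
Let b k := a k - a k.-1.
Let v k := b k - lam * b k.-1.

(** Boundary term of a summation by parts: the last [r] values of [w] up to index [M], each paired
    with [zeta] at an index larger by [r]. *)
Definition window_sum (r : nat) (w : nat -> R) M :=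
  \sum_(i < r) zeta (M.+1 + i) * w (M.+1 + i - r)%N.

Lemma window_sumS r (w : nat -> R) M : (0 < r)%N ->
  window_sum r w M.+1 =
  window_sum r w M + zeta (M.+1 + r) * w M.+1 - zeta M.+1 * w (M.+1 - r)%N.
Proof.
move=> r0; pose f i := zeta (M.+1 + i) * w (M.+1 + i - r)%N.
have e1 : \sum_(i < r.+1) f i = window_sum r w M + f r by rewrite big_ord_recr.
have e2 : \sum_(i < r.+1) f i = f 0%N + window_sum r w M.+1.
  rewrite big_ord_recl; congr (_ + _); apply: eq_bigr => i _.
  by rewrite /f /= /bump leq0n add1n !addSn !addnS.
have e3 : f 0%N = zeta M.+1 * w (M.+1 - r)%N by rewrite /f addn0.
have e4 : f r = zeta (M.+1 + r) * w M.+1 by rewrite /f addnK.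
by rewrite -e3 -e4; lra.
Qed.

Lemma count_rec k : a k.+1 = a (k.+1 - p)%N + a (k.+1 - q)%N.
Proof. by rewrite /a level_countE// natrD. Qed.

Lemma increment_rec k : b k.+2 = b (k.+2 - p)%N + b (k.+2 - q)%N.
Proof.
have predB r : (0 < r)%N -> (k.+2 - r).-1 = (k.+1 - r)%N by lia.
by rewrite /b /= !count_rec !predB//; ring.
Qed.

Lemma adjusted_increment_rec k : v k.+3 = v (k.+3 - p)%N + v (k.+3 - q)%N.
Proof.
have predB r : (0 < r)%N -> (k.+3 - r).-1 = (k.+2 - r)%N by lia.
by rewrite /v /= !increment_rec !predB//; ring.
Qed.

Lemma increment0 : b 0 = 0. Proof. by rewrite /b subrr. Qed.

Lemma increment1 : b 1 = 1.
Proof.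
rewrite /b count_rec; have -> : (1 - p = 0)%N by lia.
have -> : (1 - q = 0)%N by lia.
by rewrite /a level_count0 addrK.
Qed.

(** Passing to [k.+1] changes the sum by [zeta k.+1] times the defect of [v] in the recurrence. This
    defect is [1] at index 1, [- lam] at index 2 and [0] from index 3 on. *)
Lemma conserved_window_sum M :
  window_sum p v M.+2 + window_sum q v M.+2 = zeta 1 - lam * zeta 2.
Proof.
have step k : window_sum p v k.+1 + window_sum q v k.+1 =
    window_sum p v k + window_sum q v k +
    zeta k.+1 * (v k.+1 - v (k.+1 - p)%N - v (k.+1 - q)%N).
  rewrite !window_sumS//.
  have -> : zeta (k.+1 + p)%N = zeta k.+1 - zeta (k.+1 + q)%N.
    by rewrite [zeta k.+1]zetaE addrK.
  by ring.
have v0 : v 0 = 0 by rewrite /v /= increment0; ring.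
have w0 r : window_sum r v 0 = 0.
  rewrite /window_sum big1// => i _.
  by rewrite (_ : (1 + i - r)%N = 0%N) ?v0 ?mulr0//; have := ltn_ord i; lia.
elim: M => [|M IH]; last first.
  by rewrite step IH adjusted_increment_rec; ring.
rewrite !step !w0.
have subn1p r : (0 < r)%N -> (1 - r)%N = 0%N by lia.
rewrite !subn1p// v0.
have v1 : v 1 = 1 by rewrite /v /= increment0 increment1; ring.
have predB r : (0 < r)%N -> (2 - r).-1 = (1 - r)%N by lia.
rewrite v1 /v /= increment_rec !predB// increment1 !subn1p// increment0.
by ring.
Qed.

Let ev k : v k.+3 = a k.+3 - (1 + lam) * a k.+2 + lam * a k.+1.
Proof. by rewrite /v /b /=; ring. Qed.

(** The hypothesis bounds [v] by [2 * V], so the window sums tend to 0 like [rho ^+ M]; being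
    constant, they vanish. *)
Lemma bounded_ratio_kernel (rho V : R) : 0 <= rho < 1 ->
  (forall k, `|zeta k| <= rho ^+ k) ->
  (forall k, `|a k.+2 - lam * a k.+1| <= V) -> zeta 1 = lam * zeta 2.
Proof.
move=> /andP[rho0 rho1] zrho aV.
apply/eqP; rewrite -subr_eq0; apply/negPn/negP => ne.
have V0 : 0 <= V by apply: le_trans (aV 0%N).
have vV k : `|v k.+3| <= 2 * V.
  rewrite ev (_ : _ + _ = (a k.+3 - lam * a k.+2) - (a k.+2 - lam * a k.+1)).
    by apply: le_trans (ler_normB _ _) _; have := aV k; have := aV k.+1; lra.
  by ring.
have wV r M : `|window_sum r v (M + r).+2| <= r%:R * (rho ^+ M * (2 * V)).
  apply: le_trans (ler_norm_sum _ _ _) _.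
  rewrite -[r in r%:R]card_ord mulr_natl -sumr_const ler_sum// => i _.
  rewrite normrM ler_pM//.
    apply: le_trans (zrho _) _; rewrite ler_wiXn2l// ?ltW//.
    by lia.
  by rewrite (_ : _ - r = (M + i).+3)%N; [exact: vV|lia].
have key M : `|zeta 1 - lam * zeta 2| <= rho ^+ M * ((p%:R + q%:R) * (2 * V)).
  have l0 : 0 <= rho ^+ M * (2 * V) by rewrite mulr_ge0 ?exprn_ge0//; lra.
  have lep n m (t : R) : 0 <= t -> (n%:R * (rho ^+ (M + m) * t)) <= n%:R * (rho
    ^+ M * t).
    move=> t0; rewrite ler_wpM2l ?ler0n// ler_wpM2r// ler_wiXn2l
      ?leq_addr// ltW//.
  rewrite -(conserved_window_sum (M + p + q)).
  apply: le_trans (ler_normD _ _) _.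
  have h1 := wV p (M + q)%N; have h2 := wV q (M + p)%N.
  rewrite addnAC in h1.
  have V2 : 0 <= 2 * V by lra.
  have := lep p q _ V2; have := lep q p _ V2.
  by rewrite mulrDl mulrDr !(mulrCA (rho ^+ M)); lra.
set t := `|_| in key; have t0 : 0 < t by rewrite normr_gt0.
set C := _ * (2 * V) in key.
have C0 : 0 <= C by rewrite mulr_ge0 ?addr_ge0 ?ler0n//; lra.
have : (fun M => rho ^+ M * C) @ \oo --> (0 : R).
  rewrite -[X in _ --> X](mul0r C); apply: cvgM; last exact: cvg_cst.
  by apply: cvg_expr; rewrite ger0_norm.
move=> /cvgrPdist_lt /(_ t t0)[N _ /(_ N (leqnn N))] /=.
rewrite sub0r normrN ger0_norm ?mulr_ge0 ?exprn_ge0//.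
by rewrite ltNge key.
Qed.
End Conserved.

Section RationalUnbounded.
Variable R : realType.
Implicit Types (p q : nat) (x V : R).

Lemma level_count_ratio_unbounded p q x V : (0 < q < p)%N -> coprime p q ->
  (6 < p + q)%N -> 0 < x ->
  ~ forall k, `|(level_count p q k.+2)%:R - x^-1 * (level_count p q k.+1)%:R|
      <= V.
Proof.
move=> qp copq pq6 x0 aV; have /andP[q0 q_lt_p] := qp.
have [rho [th [/andP[rho0 rho1] sth cosE sinE]]] :=
  @trinomial_root R p q qp copq pq6.
(* The phase [- th] makes [zeta 1 = 0] while [zeta 2 = rho ^+ 2 * sin th] is nonzero, so
   [zeta 1 = lam * zeta 2] fails. *)
pose zeta k : R := rho ^+ k * sin (th *+ k - th).
have zetaE k : zeta k = zeta (k + p)%N + zeta (k + q)%N.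
  rewrite /zeta !exprD !mulrnDr.
  rewrite ![th *+ k + _ - th]addrAC !(sinD (th *+ k - th)).
  set y := th *+ k - th.
  transitivity (rho ^+ k * (sin y * (rho ^+ p * cos (th *+ p) + rho ^+ q * cos
    (th *+ q))
     + cos y * (rho ^+ p * sin (th *+ p) + rho ^+ q * sin (th *+ q)))).
    by rewrite cosE sinE; ring.
  by ring.
have zrho k : `|zeta k| <= rho ^+ k.
  rewrite /zeta normrM ger0_norm ?exprn_ge0 ?(ltW rho0)//.
  by rewrite ler_piMr ?exprn_ge0 ?(ltW rho0)// sin_max.
have rho01 : 0 <= rho < 1 by rewrite ltW.
have p0 : (0 < p)%N by apply: leq_trans q_lt_p.
have := bounded_ratio_kernel p0 q0 zetaE rho01 zrho aV.
rewrite /zeta mulr1n subrr sin0 mulr0 mulr2n addrK => /esym/eqP.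
by rewrite !mulf_eq0 invr_eq0 (negPf sth) !gt_eqF ?exprn_gt0.
Qed.

(* For [(p, q) = (5, 1)] the trinomial [z ^+ 5 + z - 1] vanishes at the
   primitive sixth roots of unity, so the deviations need not be unbounded, but
   they cannot be summable either. *)
Lemma level_count51_not_summable x V : 0 < x -> x < 1 ->
  ~ forall M, exists c : R, \sum_(k < M)
      `|(level_count 5 1 k.+1)%:R - c * x^-1 ^+ k.+1| <= V.
Proof.
move=> x0 x1 aV; set lam := x^-1.
have lam0 : 0 < lam by rewrite invr_gt0.
(* Real solution attached to the primitive sixth roots of unity, with [zeta 1 = 0] and [zeta 2 = 1];
   the conserved value is [- lam]. *)
pose zeta k : R := nth 0 [:: -1; 0; 1; 1; 0; -1] (k %% 6).
have zetaE k : zeta k = zeta (k + 5)%N + zeta (k + 1)%N.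
  rewrite /zeta -(modnDml k 5) -(modnDml k 1).
  have : (k %% 6 < 6)%N by rewrite ltn_mod.
  by case: (k %% 6)%N => [|[|[|[|[|[|//]]]]]] _ /=; ring.
have z1 k : `|zeta k| <= 1.
  rewrite /zeta; have : (k %% 6 < 6)%N by rewrite ltn_mod.
  by case: (k %% 6)%N => [|[|[|[|[|[|//]]]]]] _ /=;
    rewrite ?normrN ?normr0 ?normr1 ?ler01.
pose a k : R := (level_count 5 1 k)%:R.
pose b k := a k - a k.-1.
pose v k := b k - lam * b k.-1.
have J M := @conserved_window_sum R 5 1 lam zeta isT isT zetaE M.
have vE k : v k.+3 = a k.+3 - (1 + lam) * a k.+2 + lam * a k.+1.
  by rewrite /v /b /=; ring.
have main m : lam <= 2 * \sum_(i < 5) `|v (m + i).+3|.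
  have l0 : `|zeta 1 - lam * zeta 2| = lam.
    by rewrite /zeta/= mulr1 sub0r normrN gtr0_norm.
  rewrite -l0 -(J (m + 5)%N); apply: le_trans (ler_normD _ _) _.
  have w5 : `|window_sum zeta 5 v (m + 5).+2| <= \sum_(i < 5) `|v (m + i).+3|.
    apply: le_trans (ler_norm_sum _ _ _) _; apply: ler_sum => i _.
    rewrite normrM (_ : _ - 5 = (m + i).+3)%N; last by lia.
    by rewrite ler_piMl.
  have w1 : `|window_sum zeta 1 v (m + 5).+2| <= \sum_(i < 5) `|v (m + i).+3|.
    rewrite /window_sum big_ord1 normrM (_ : _ - 1 = (m + 4).+3)%N; last first.
      by rewrite /=; lia.
    rewrite big_ord_recr /=.
    apply: (@le_trans _ _ `|v (m + 4).+3|); first by rewrite ler_piMl.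
    by rewrite lerDr sumr_ge0.
  by move: (lerD w5 w1); rewrite mulr_natl mulr2n.
have [N NV] : exists N : nat, 6 * (1 + lam) * V < N%:R * lam.
  exists (Num.truncn (6 * (1 + lam) * V / lam)).+1.
  by rewrite -ltr_pdivrMr// truncnS_gt.
have [c cV] := aV (7 * N)%N.
pose e k : R := a k.+1 - c * lam ^+ k.+1.
have ve k : `|v k.+3| <= (1 + lam) * (`|e k| + `|e k.+1| + `|e k.+2|).
  rewrite vE (_ : _ + _ = e k.+2 - (1 + lam) * e k.+1 + lam * e k); last first.
    by rewrite /e [lam ^+ k.+3]exprS [lam ^+ k.+2]exprS; ring.
  apply: le_trans (ler_normD _ _) _.
  have := ler_normB (e k.+2) ((1 + lam) * e k.+1).
  rewrite !normrM (gtr0_norm lam0) (gtr0_norm (_ : 0 < 1 + lam)); last by lra.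
  have := normr_ge0 (e k); have := normr_ge0 (e k.+1);
    have := normr_ge0 (e k.+2).
  by nra.
(* Five consecutive terms of [v] carry total absolute value at least [lam / 2], and each is
   controlled by three consecutive deviations. Hence every block of seven deviations has a fixed
   positive sum, whatever [c] is. *)
have block m : lam <= 6 * (1 + lam) * \sum_(i < 7) `|e (m + i)%N|.
  apply: le_trans (main m) _.
  have : \sum_(i < 5) `|v (m + i).+3| <=
      (1 + lam) * (3 * \sum_(i < 7) `|e (m + i)%N|).
    apply: (@le_trans _ _ (\sum_(i < 5) ((1 + lam) *
       (`|e (m + i)| + `|e (m + i).+1| + `|e (m + i).+2|)))).
      by apply: ler_sum => i _; exact: ve.
    rewrite -mulr_sumr ler_wpM2l//; first by lra.
    pose f i := `|e (m + i)%N|.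
    have f0 i : 0 <= f i by exact: normr_ge0.
    rewrite (eq_bigr (fun i : 'I_5 => f i + f i.+1 + f i.+2)); last first.
      by move=> i _; rewrite /f !addnS.
    rewrite [X in _ <= 3 * X](eq_bigr (fun i : 'I_7 => f i))//.
    rewrite !big_ord_recr !big_ord0 /=.
    by have := f0 0%N; have := f0 1%N; have := f0 5%N; have := f0 6%N; lra.
  by lra.
have total n : n%:R * lam <= 6 * (1 + lam) * \sum_(k < 7 * n) `|e k|.
  elim: n => [|n IH]; first by rewrite mul0r big_ord0 mulr0.
  rewrite mulnS addnC big_split_ord /= mulrDr -natr1 mulrDl mul1r.
  by apply: lerD => //; exact: block.
have := total N; rewrite leNgt => /negP; apply.
apply: le_lt_trans NV; rewrite ler_wpM2l//.
by rewrite mulr_ge0//; lra.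
Qed.
End RationalUnbounded.

(** * Subdivided intervals *)

Lemma gt1_of_mul (R : realDomainType) (t y : R) :
  0 <= t -> t <= 1 -> 1 < t * y -> 1 < y.
Proof.
move=> t0 t1 ty; have tn0 : 0 < t.
  by rewrite lt_neqAle t0 andbT eq_sym; apply/eqP => te;
    rewrite te mul0r in ty; lra.
by nra.
Qed.

Section Subdivision.
Variable R : realType.
Variable alpha : R.
Hypotheses (alpha_gt0 : 0 < alpha) (alpha_lt1 : alpha < 1).
Implicit Types (u s c K : R) (l : seq R).

(* [subdivided u s l]: [l] lists in order the right endpoints of the tiles that
   replace [[u, u + s]] when all tiles longer than 1 are substituted. *)
Inductive subdivided : R -> R -> seq R -> Prop :=
| subdivided_leaf u s : 0 < s -> s <= 1 -> subdivided u s [:: u + s]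
| subdivided_node u s l1 l2 : 1 < s -> subdivided u (alpha * s) l1 ->
    subdivided (u + alpha * s) ((1 - alpha) * s) l2 ->
    subdivided u s (l1 ++ l2).

Definition breakpoint u l i := nth 0 (u :: l) i.

Definition small_deviation K c (f : nat -> R) i j :=
  forall m n, (i <= m)%N -> (m <= n)%N -> (n <= j)%N ->
    `|n%:R - m%:R - c * (f n - f m)| <= K.

Definition evenly_spread K c u l := small_deviation K c (breakpoint u l) 0
  (size l).

Lemma breakpoint_catl u l1 l2 i : (i <= size l1)%N ->
  breakpoint u (l1 ++ l2) i = breakpoint u l1 i.
Proof. by move=> il; rewrite /breakpoint -cat_cons nth_cat /= ltnS il. Qed.

Lemma breakpoint_last u l : breakpoint u l (size l) = last u l.
Proof. by rewrite /breakpoint -[size l]/(size (u :: l)).-1 nth_last. Qed.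

Lemma breakpoint_catr u l1 l2 j :
  breakpoint u (l1 ++ l2) (size l1 + j) = breakpoint (last u l1) l2 j.
Proof.
case: j => [|j]; first by rewrite addn0 breakpoint_catl// breakpoint_last.
rewrite /breakpoint -cat_cons nth_cat/= ltnNge.
by rewrite addnS ltnS leq_addr /= subSS addKn.
Qed.

Lemma subdivided_gt0 u s l : subdivided u s l -> 0 < s.
Proof. by case=> // ? ? ? ? s1 _ _; apply: lt_trans s1. Qed.

Lemma subdivided_size u s l : subdivided u s l -> (0 < size l)%N.
Proof. by elim=> // *; rewrite size_cat addn_gt0; apply/orP; left. Qed.

Lemma subdivided_last u s l : subdivided u s l -> last u l = u + s.
Proof.
elim=> // {}u {}s l1 l2 s1 _ e1 _ e2.
by rewrite last_cat e1 e2; ring.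
Qed.

Lemma breakpointDr u s l1 l2 j : subdivided u s l1 ->
  breakpoint u (l1 ++ l2) (size l1 + j) = breakpoint (u + s) l2 j.
Proof. by move=> /subdivided_last e; rewrite breakpoint_catr e. Qed.

Let beta := Num.min alpha (1 - alpha).

Let beta_gt0 : 0 < beta.
Proof. by rewrite lt_min alpha_gt0 subr_gt0. Qed.

Let beta_lt1 : beta < 1.
Proof. by rewrite gt_min alpha_lt1. Qed.

Let beta_le_alpha : beta <= alpha. Proof. by rewrite ge_min lexx. Qed.

Let beta_le_calpha : beta <= 1 - alpha.
Proof. by rewrite ge_min lexx orbT. Qed.

(** Only pieces longer than 1 are cut, so both parts of a cut piece keep length at least [beta]. *)
Lemma subdivided_tile_length u s l : subdivided u s l -> beta <= s ->
  forall i, (i < size l)%N ->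
  beta <= breakpoint u l i.+1 - breakpoint u l i <= 1.
Proof.
elim=> {u s l} [u s s0 s1 bs [|//] _|u s l1 l2 s1 d1 IH1 d2 IH2 bs i].
  by rewrite /breakpoint /=; apply/andP; split; lra.
have b1 : beta <= alpha * s.
  by apply: (le_trans beta_le_alpha); rewrite ler_peMr// ltW.
have b2 : beta <= (1 - alpha) * s.
  by apply: (le_trans beta_le_calpha); rewrite ler_peMr ?subr_ge0// ltW.
rewrite size_cat; have [i1|i1] := ltnP i (size l1).
  by move=> _; rewrite !breakpoint_catl ?(ltnW i1)//; apply: IH1.
rewrite -{1}(subnKC i1) ltn_add2l => i2.
rewrite -(subnKC i1) -addnS !(breakpointDr _ _ d1).
exact: IH2.
Qed.

Lemma breakpoint_le u s l : subdivided u s l -> beta <= s ->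
  forall i j, (i <= j)%N -> (j <= size l)%N -> breakpoint u l i <= breakpoint u
    l j.
Proof.
move=> d bs i; elim=> [|j IH]; first by rewrite leqn0 => /eqP ->.
rewrite leq_eqVlt => /orP[/eqP->//|]; rewrite ltnS => ij jl.
apply: le_trans (IH ij (ltnW jl)) _.
by have /andP[h _] := subdivided_tile_length d bs jl; move: beta_gt0; lra.
Qed.

Lemma substitute_longU (P Q : set (R * R)) :
  substitute_long alpha (P `|` Q) =
  substitute_long alpha P `|` substitute_long alpha Q.
Proof. by rewrite /substitute_long bigcup_setU. Qed.

Lemma iter_substitute_longU n (P Q : set (R * R)) :
  iter n (substitute_long alpha) (P `|` Q) =
  iter n (substitute_long alpha) P `|` iter n (substitute_long alpha) Q.
Proof. by elim: n => //= n ->; rewrite substitute_longU. Qed.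

(** Passes from sets of tiles to the ordered tree. As [substitute_long] distributes over unions, the
    first cut splits the iteration into independent iterations on the two parts. *)
Lemma iter_substitute_subdivided n u s : 0 < s ->
  (forall T, iter n (substitute_long alpha) [set (u, u + s)] T ->
     tile_length T <= 1) ->
  exists2 l, subdivided u s l &
    forall T, iter n (substitute_long alpha) [set (u, u + s)] T ->
      exists2 i, (i < size l)%N & T = (breakpoint u l i, breakpoint u l i.+1).
Proof.
have leaf m v t : t <= 1 ->
    iter m (substitute_long alpha) [set (v, v + t)] = [set (v, v + t)].
  move=> t1; elim: m => //= m ->.
  rewrite /substitute_long bigcup_set1 /tile_length /=.
  by rewrite addrAC subrr add0r ltNge t1.
have leafE m v t : 0 < t -> t <= 1 -> exists2 l, subdivided v t l &
    forall T, iter m (substitute_long alpha) [set (v, v + t)] T ->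
      exists2 i, (i < size l)%N & T = (breakpoint v l i, breakpoint v l i.+1).
  move=> t0 t1; exists [:: v + t]; first exact: subdivided_leaf.
  by move=> T; rewrite leaf// => ->; exists 0%N.
elim: n u s => [|n IH] u s s0 short.
  have s1 : s <= 1.
    by have := short (u, u + s) erefl; rewrite /tile_length/= addrAC subrr
      add0r.
  exact: (leafE 0%N).
have [s1|s1] := leP s 1; first exact: (leafE n.+1).
have step : iter n.+1 (substitute_long alpha) [set (u, u + s)] =
    iter n (substitute_long alpha) [set (u, u + alpha * s)] `|`
    iter n (substitute_long alpha)
      [set (u + alpha * s, u + alpha * s + (1 - alpha) * s)].
  rewrite iterSr -iter_substitute_longU; congr iter.
  rewrite /substitute_long bigcup_set1 /tile_length /= addrAC subrr add0r s1.
  rewrite /substitute /tile_length /= addrAC subrr add0r.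
  by rewrite (_ : u + alpha * s + (1 - alpha) * s = u + s)//; ring.
rewrite step in short *.
have [||l1 d1 h1] := IH u (alpha * s).
- by rewrite mulr_gt0.
- by move=> T hT; apply: short; left.
have [||l2 d2 h2] := IH (u + alpha * s) ((1 - alpha) * s).
- by rewrite mulr_gt0// subr_gt0.
- by move=> T hT; apply: short; right.
exists (l1 ++ l2); first exact: subdivided_node.
move=> T [/h1|/h2] [i il ->].
  exists i; first by rewrite size_cat ltn_addr.
  by rewrite !breakpoint_catl// ltnW.
exists (size l1 + i)%N; first by rewrite size_cat ltn_add2l.
by rewrite -addnS !(breakpointDr _ _ d1).
Qed.

Lemma kakutani_patch_subdivided t a P : is_kakutani_patch alpha t a P ->
  exists2 l, subdivided (expR t * a) (expR t) l &
    forall T, P T -> exists2 i, (i < size l)%N &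
      T = (breakpoint (expR t * a) l i, breakpoint (expR t * a) l i.+1).
Proof.
move=> [n ->]; rewrite mulrDr mulr1 => short.
exact: iter_substitute_subdivided (expR_gt0 t) short.
Qed.

Lemma small_deviation_sub K c f g i j k m :
  small_deviation K c f i j ->
  (i <= k)%N -> (k + m <= j)%N -> (forall n, (n <= m)%N -> g n = f (k + n)%N) ->
  small_deviation K c g 0 m.
Proof.
move=> good ik kmj gf a b _ ab bm; rewrite !gf ?(leq_trans ab)//.
have := good (k + a)%N (k + b)%N; rewrite !natrD.
rewrite (_ : k%:R + b%:R - (k%:R + a%:R) = b%:R - a%:R); last by ring.
by apply; lia.
Qed.

Lemma evenly_spread_catl K c u l1 l2 : evenly_spread K c u (l1 ++ l2) ->
  evenly_spread K c u l1.
Proof.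
move=> good; apply: (small_deviation_sub (k := 0%N) good) => //.
  by rewrite size_cat leq_addr.
by move=> n nl; rewrite breakpoint_catl.
Qed.

Lemma evenly_spread_catr K c u s l1 l2 : subdivided u s l1 ->
  evenly_spread K c u (l1 ++ l2) -> evenly_spread K c (u + s) l2.
Proof.
move=> d good; apply: (small_deviation_sub (k := size l1) good) => //.
  by rewrite size_cat.
by move=> n nl; rewrite (breakpointDr _ _ d).
Qed.

(** Descend to the left while the run ends in the left child. Once it reaches beyond, it contains
    that whole child, whose length [alpha * s] is at least [beta] times that of the run. *)
Lemma subdivided_prefix u s l : subdivided u s l -> forall K c j,
  (0 < j)%N -> (j <= size l)%N ->
  small_deviation K c (breakpoint u l) 0 j ->
  exists u' s' l', [/\ subdivided u' s' l', evenly_spread K c u' l' &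
    beta * (breakpoint u l j - u) <= s'].
Proof.
elim=> {u s l} [u s s0 s1 K c j j0 jl good|u s l1 l2 s1 d1 IH1 d2 IH2 K c j j0].
  have j1 : j = 1%N by move: j0 jl => /=; lia.
  exists u, s, [:: u + s]; split.
  - exact: subdivided_leaf.
  - by rewrite /evenly_spread /= -j1.
  - by rewrite j1 /breakpoint/= addrAC subrr add0r ler_piMl ?(ltW beta_lt1)
    ?(ltW s0).
have [j1 _ good|j1] := leqP j (size l1).
  have [|u' [s' [l' [d' g' b']]]] := IH1 K c j j0 j1.
    apply: (small_deviation_sub (k := 0%N) good) => // n nj.
    by rewrite breakpoint_catl// (leq_trans nj).
  by exists u', s', l'; split => //; rewrite breakpoint_catl.
have d := subdivided_node s1 d1 d2.
rewrite leq_eqVlt => /orP[/eqP jE|jl] good.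
  exists u, s, (l1 ++ l2); split => //; first by rewrite /evenly_spread -jE.
  rewrite jE breakpoint_last (subdivided_last d) addrAC subrr add0r.
  by rewrite ler_piMl ?(ltW beta_lt1)// (ltW (subdivided_gt0 d)).
exists u, (alpha * s), l1; split => //.
  apply: (small_deviation_sub (k := 0%N) good) => //; first exact: ltnW.
  by move=> n nl; rewrite breakpoint_catl.
have := breakpoint_le d _ (ltnW jl) (leqnn _).
rewrite breakpoint_last (subdivided_last d).
move=> /(_ (le_trans (ltW beta_lt1) (ltW s1))) h.
apply: ler_pM => //; first exact: ltW.
- rewrite subr_ge0 -[u]/(breakpoint u (l1 ++ l2) 0).
  apply: (breakpoint_le d) => //; last exact: ltnW.
  exact: le_trans (ltW beta_lt1) (ltW s1).
- by rewrite lerBlDl.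
Qed.

Lemma subdivided_suffix u s l : subdivided u s l -> forall K c i,
  (i < size l)%N ->
  small_deviation K c (breakpoint u l) i (size l) ->
  exists u' s' l', [/\ subdivided u' s' l', evenly_spread K c u' l' &
    beta * (u + s - breakpoint u l i) <= s'].
Proof.
elim=> {u s l} [u s s0 s1 K c i il good|u s l1 l2 s1 d1 IH1 d2 IH2 K c i il
  good].
  have i0 : i = 0%N by move: il => /=; lia.
  exists u, s, [:: u + s]; split.
  - exact: subdivided_leaf.
  - by move: good; rewrite i0.
  - by rewrite i0 /breakpoint/= addrAC subrr add0r ler_piMl ?(ltW beta_lt1)
    ?(ltW s0).
have d := subdivided_node s1 d1 d2.
have [i1|i1] := leqP (size l1) i.
  have [||u' [s' [l' [d' g' b']]]] := IH2 K c (i - size l1)%N.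
  - by move: il; rewrite size_cat; lia.
  - move=> m n im mn nj.
    have := good (size l1 + m)%N (size l1 + n)%N.
    rewrite !(breakpointDr _ _ d1) !natrD size_cat.
    rewrite (_ : _%:R + n%:R - (_ + m%:R) = n%:R - m%:R); last by ring.
    by apply; lia.
  exists u', s', l'; split => //.
  move: b'; rewrite -(breakpointDr _ _ d1) subnKC//.
  by rewrite (_ : u + alpha * s + (1 - alpha) * s = u + s); last by ring.
have bs : beta <= s := le_trans (ltW beta_lt1) (ltW s1).
have [i0|i0] := posnP i.
  exists u, s, (l1 ++ l2); split => //; first by move: good; rewrite i0.
  rewrite i0 /breakpoint /= addrAC subrr add0r.
  by rewrite ler_piMl ?(ltW beta_lt1)// (ltW (subdivided_gt0 d)).
exists (u + alpha * s), ((1 - alpha) * s), l2; split => //.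
  apply: (small_deviation_sub (k := size l1) good) => //.
  - exact: ltnW.
  - by rewrite size_cat.
  by move=> n nl; rewrite (breakpointDr _ _ d1).
have h := breakpoint_le d bs (leq0n i) (ltnW il).
rewrite /breakpoint /= -/(breakpoint u (l1 ++ l2) i) in h.
have h' := breakpoint_le d bs (ltnW il) (leqnn _).
rewrite breakpoint_last (subdivided_last d) in h'.
apply: ler_pM => //; first exact: ltW.
- by rewrite subr_ge0.
- by lra.
Qed.

(** At the deepest node containing the run, the run either is a single tile or straddles the cut. In
    the latter case at least half of its length lies on one side, as a suffix of the left child or a
    prefix of the right one; hence the factor [beta / 2]. *)
Lemma subdivided_range u s l : subdivided u s l -> forall K c i j,
  (i < j)%N -> (j <= size l)%N ->
  small_deviation K c (breakpoint u l) i j ->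
  exists u' s' l', [/\ subdivided u' s' l', evenly_spread K c u' l' &
    beta / 2 * (breakpoint u l j - breakpoint u l i) <= s'].
Proof.
have half (t y : R) : 0 <= y -> beta * y <= t -> beta / 2 * y <= t.
  move=> y0; apply: le_trans; rewrite ler_wpM2r//; move: beta_gt0; lra.
elim=> {u s l} [u s s0 s1 K c i j ij jl good|u s l1 l2 s1 d1 IH1 d2 IH2 K c i j
  ij jl good].
  have [i0 j1] : i = 0%N /\ j = 1%N by move: ij jl => /=; lia.
  exists u, s, [:: u + s]; split.
  - exact: subdivided_leaf.
  - by move: good; rewrite i0 j1.
  - rewrite i0 j1 /breakpoint/= addrAC subrr add0r; apply: half;
    first exact: ltW.
    by rewrite ler_piMl ?(ltW beta_lt1) ?(ltW s0).
have [j1|j1] := leqP j (size l1).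
  have [|u' [s' [l' [d' g' b']]]] := IH1 K c i j ij j1.
    move=> m n im mn nj; have := good m n im mn nj.
    by rewrite !breakpoint_catl ?(leq_trans _ j1) ?(leq_trans mn).
  exists u', s', l'; split => //.
  by rewrite !breakpoint_catl// (leq_trans (ltnW ij)).
have [i1|i1] := leqP (size l1) i.
  have [|||u' [s' [l' [d' g' b']]]] := IH2 K c (i - size l1)%N (j - size l1)%N.
  - by lia.
  - by move: jl; rewrite size_cat; lia.
  - move=> m n im mn nj.
    have := good (size l1 + m)%N (size l1 + n)%N.
    rewrite !(breakpointDr _ _ d1) !natrD.
    rewrite (_ : _%:R + n%:R - (_ + m%:R) = n%:R - m%:R); last by ring.
    by apply; lia.
  exists u', s', l'; split => //.
  by move: b'; rewrite -!(breakpointDr _ _ d1) !subnKC// ltnW.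
have as0 : beta <= alpha * s by apply: (le_trans beta_le_alpha);
  rewrite ler_peMr// ltW.
have bs0 : beta <= (1 - alpha) * s.
  by apply: (le_trans beta_le_calpha); rewrite ler_peMr ?subr_ge0// ltW.
set v := u + alpha * s.
have j2 : (j - size l1 <= size l2)%N by rewrite leq_subLR -size_cat.
have bj : breakpoint u (l1 ++ l2) j = breakpoint v l2 (j - size l1).
  by rewrite -(breakpointDr _ _ d1) subnKC// ltnW.
have bi : breakpoint u (l1 ++ l2) i = breakpoint u l1 i.
  by rewrite breakpoint_catl// ltnW.
have vj : v <= breakpoint v l2 (j - size l1).
  by have := breakpoint_le d2 bs0 (leq0n (j - size l1)) j2.
have iv : breakpoint u l1 i <= v.
  have := breakpoint_le d1 as0 (ltnW i1) (leqnn _).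
  by rewrite breakpoint_last (subdivided_last d1).
rewrite bj bi; have [le|le] := leP (breakpoint v l2 (j - size l1) - v) (v -
  breakpoint u l1 i).
  have [|u' [s' [l' [d' g' b']]]] := subdivided_suffix d1 (K := K) (c := c) i1.
    move=> m n im mn nj; have := good m n im mn (leq_trans nj (ltnW j1)).
    by rewrite !breakpoint_catl// (leq_trans mn).
  exists u', s', l'; split => //; apply: le_trans b'; rewrite -/v.
  by move: beta_gt0; nra.
have [||u' [s' [l' [d' g' b']]]] := subdivided_prefix d2 (K := K) (c := c) _ j2.
- by rewrite subn_gt0.
- apply: (small_deviation_sub (k := size l1) good); first exact: ltnW.
    by rewrite subnKC// ltnW.
  by move=> n nl; rewrite (breakpointDr _ _ d1).
exists u', s', l'; split => //; apply: le_trans b'; rewrite -/v.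
by move: beta_gt0; nra.
Qed.

Lemma evenly_spread_size u s l K c : subdivided u s l -> evenly_spread K c u l
  ->
  `|(size l)%:R - c * s| <= K.
Proof.
move=> d /(_ 0%N (size l) isT isT (leqnn _)).
rewrite breakpoint_last (subdivided_last d) subr0 /breakpoint /=.
by rewrite addrAC subrr add0r.
Qed.

(** Every length on the path exceeds the last one, hence 1, so all these nodes are really cut. The
    tiles of a subtile are consecutive, so even spreading is inherited. *)
Lemma subdivided_descend u s l K c m n : subdivided u s l -> evenly_spread K c
  u l ->
  1 < alpha ^+ m * (1 - alpha) ^+ n * s ->
  exists u' l', subdivided u' (alpha ^+ m * (1 - alpha) ^+ n * s) l' /\
    evenly_spread K c u' l'.
Proof.
have a0 := ltW alpha_gt0; have a1 := ltW alpha_lt1.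
elim: m u s l => [|m IHm] u s l.
  elim: n u s l => [|n IHn] u s l d g; first by rewrite !expr0 !mul1r;
    exists u, l.
  rewrite expr0 mul1r exprS -mulrA mulrCA => h.
  have s1 : 1 < (1 - alpha) * s.
    apply: gt1_of_mul h; first by rewrite exprn_ge0// subr_ge0.
    by rewrite exprn_ile1//; lra.
  have s2 : 1 < s by apply: gt1_of_mul s1; lra.
  case: d g s1 s2 h => {u s l} [u s _ s1|u s l1 l2 _ d1 d2] g s1' s2 h.
    by lra.
  have := IHn _ _ _ d2 (evenly_spread_catr d1 g).
  by rewrite expr0 mul1r; apply.
move=> d g; rewrite exprS -!mulrA [_ ^+ n * s]mulrC.
rewrite [alpha * _]mulrCA [alpha * (_ * _)]mulrA [_ * (1 - alpha) ^+ n]mulrC.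
rewrite [alpha ^+ m * _]mulrA => h.
have s1 : 1 < alpha * s.
  apply: gt1_of_mul h; first by rewrite mulr_ge0 ?exprn_ge0// subr_ge0.
  by rewrite mulr_ile1 ?exprn_ge0 ?exprn_ile1 ?subr_ge0//; lra.
have s2 : 1 < s by apply: gt1_of_mul s1.
case: d g s1 s2 h => {u s l} [u s _ s1|u s l1 l2 _ d1 d2] g s1' s2 h.
  by lra.
exact: (IHm _ _ _ d1 (evenly_spread_catl g) h).
Qed.

End Subdivision.

(** * Incommensurable ratios *)

Section Incommensurable.
Variable R : realType.
Variable alpha : R.
Hypotheses (alpha_gt0 : 0 < alpha) (alpha_lt1 : alpha < 1).
Implicit Types (u s c K : R) (l : seq R).

Let calpha_gt0 : 0 < 1 - alpha. Proof. by rewrite subr_gt0. Qed.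

Let calpha_le1 : 1 - alpha <= 1. Proof. by rewrite gerBl ltW. Qed.

Lemma subdivided_size_le u s l u' s' l' : subdivided alpha u s l ->
  subdivided alpha u' s' l' -> s <= s' -> (size l <= size l')%N.
Proof.
move=> d; elim: d u' s' l' => {u s l} [u s _ _ u' s' l' /subdivided_size//|].
move=> u s l1 l2 s1 d1 IH1 d2 IH2 u' s' l' d'.
case: d' => {u' s' l'} [u' s' _ s'1 ss'|u' s' l1' l2' s'1 d1' d2' ss'].
  by have := lt_le_trans s1 ss'; rewrite ltNge s'1.
rewrite !size_cat leq_add//.
  by apply: IH1 d1' _; rewrite ler_pM2l.
by apply: IH2 d2' _; rewrite ler_pM2l.
Qed.

(** Along the path of [n] right cuts, the node at the end is cut in the second tree but not in the
    first, and elsewhere the second tree has at least as many tiles. *)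
Lemma subdivided_size_lt n u s l u' s' l' : subdivided alpha u s l ->
  subdivided alpha u' s' l' ->
  (1 - alpha) ^+ n * s <= 1 -> 1 < (1 - alpha) ^+ n * s' ->
  (size l < size l')%N.
Proof.
elim: n u s l u' s' l' => [|n IH] u s l u' s' l' d d' sn s'n.
  rewrite expr0 !mul1r in sn s'n.
  case: d sn => {u s l} [u s _ s1 _|u s l1 l2 s1 _ _]; last by rewrite leNgt s1.
  case: d' s'n => {u' s' l'} [u' s' _ s1'|u' s' l1' l2' _ d1 d2 _].
    by rewrite ltNge s1'.
  have := subdivided_size d1; have := subdivided_size d2.
  by rewrite size_cat /=; clear; lia.
have c1 : (1 - alpha) ^+ n.+1 <= 1 by rewrite exprn_ile1// ltW.
have s'1 : 1 < s'.
  by apply: gt1_of_mul s'n; rewrite ?exprn_ge0 ?(ltW calpha_gt0).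
case: d' s'1 s'n => {u' s' l'} [u' s' _ s1'|u' s' l1' l2' _ d1' d2' s'1 s'n].
  by rewrite ltNge s1'.
rewrite exprSr -mulrA in s'n; rewrite exprSr -mulrA in sn.
rewrite size_cat.
case: d sn => {u s l} [u s s0 s1 sn|u s l1 l2 s1 d1 d2 sn].
  have h : (1 - alpha) ^+ n * s <= 1.
    by rewrite mulr_ile1// ?exprn_ge0 ?exprn_ile1 ?(ltW calpha_gt0) ?(ltW s0).
  have := IH _ _ _ _ _ _ (subdivided_leaf alpha u s0 s1) d2' h s'n.
  by have := subdivided_size d1'; rewrite /=; clear; lia.
rewrite size_cat.
have := IH _ _ _ _ _ _ d2 d2' sn s'n.
have ss' : alpha * s <= alpha * s'.
  rewrite ler_pM2l//.
  have := le_lt_trans sn s'n.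
  by rewrite ltr_pM2l ?exprn_gt0// ltr_pM2l// => /ltW.
by have := subdivided_size_le d1 d1' ss'; clear; lia.
Qed.

(* The number of tiles jumps by at least [n + 1] at the length
   [alpha^-1 * (1 - alpha)^-n], as [n + 1] words reach this threshold. *)
Lemma subdivided_size_jump n u s l u' s' l' : subdivided alpha u s l ->
  subdivided alpha u' s' l' ->
  alpha * (1 - alpha) ^+ n * s <= 1 -> 1 < alpha * (1 - alpha) ^+ n * s' ->
  (size l + n < size l')%N.
Proof.
elim: n u s l u' s' l' => [|n IH] u s l u' s' l' d d' sn s'n.
  rewrite expr0 !mulr1 in sn s'n.
  have s'1 : 1 < s' by apply: gt1_of_mul s'n; exact: ltW.
  case: d' s'1 s'n => {u' s' l'} [u' s' _ s1'|u' s' l1' l2' _ d1' d2' s'1 s'n].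
    by rewrite ltNge s1'.
  rewrite size_cat.
  have := subdivided_size d1'; have := subdivided_size d2'.
  case: d sn => {u s l} [u s s0 s1 sn|u s l1 l2 s1 d1 d2 sn].
    by rewrite /=; clear; lia.
  rewrite size_cat.
  have := @subdivided_size_lt 0 _ _ _ _ _ _ d1 d1'; rewrite expr0 !mul1r.
  move=> /(_ sn s'n).
  have ss' : (1 - alpha) * s <= (1 - alpha) * s'.
    rewrite ler_pM2l//; have := le_lt_trans sn s'n.
    by rewrite ltr_pM2l// => /ltW.
  by have := subdivided_size_le d2 d2' ss'; clear; lia.
set b : R := (1 - alpha) in sn s'n IH *.
have b1 : b ^+ n.+1 <= 1 by rewrite exprn_ile1// ltW.
have bn0 : 0 < b ^+ n.+1 by rewrite exprn_gt0.
have ab1 : alpha * b ^+ n.+1 <= 1 by rewrite mulr_ile1 ?(ltW bn0)// ltW.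
have s'1 : 1 < s'.
  by apply: gt1_of_mul ab1 s'n; rewrite mulr_ge0 ?(ltW bn0)// ltW.
case: d' s'1 s'n => {u' s' l'} [u' s' _ s1'|u' s' l1' l2' _ d1' d2' s'1 s'n].
  by rewrite ltNge s1'.
have s'n1 : 1 < b ^+ n.+1 * (alpha * s') by rewrite mulrA [_ * alpha]mulrC.
have s'n2 : 1 < alpha * b ^+ n * (b * s') by rewrite mulrA -[_ * b]mulrA
  -exprSr.
rewrite size_cat.
case: d sn => {u s l} [u s s0 s1 sn|u s l1 l2 s1 d1 d2 sn].
  have d := subdivided_leaf alpha u s0 s1.
  have bn1 : b ^+ n <= 1 by rewrite exprn_ile1// ltW.
  have bn0' : 0 < b ^+ n by rewrite exprn_gt0.
  have h1 : b ^+ n.+1 * s <= 1 by rewrite mulr_ile1// ltW.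
  have h2 : alpha * b ^+ n * s <= 1.
    by rewrite mulr_ile1 ?mulr_ile1 ?mulr_ge0// ltW.
  have := subdivided_size_lt d d1' h1 s'n1.
  have := IH _ _ _ _ _ _ d d2' h2 s'n2.
  by rewrite /=; clear; lia.
have sn1 : b ^+ n.+1 * (alpha * s) <= 1 by rewrite mulrA [_ * alpha]mulrC.
have sn2 : alpha * b ^+ n * (b * s) <= 1 by rewrite mulrA -[_ * b]mulrA -exprSr.
have := subdivided_size_lt d1 d1' sn1 s'n1.
have := IH _ _ _ _ _ _ d2 d2' sn2 s'n2.
by rewrite size_cat; clear; lia.
Qed.

Lemma exprn_small (z e : R) : 0 <= z -> z < 1 -> 0 < e -> exists n, z ^+ n <= e.
Proof.
move=> z0 z1 e0; have : (fun n => z ^+ n) @ \oo --> (0 : R).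
  by apply: cvg_expr; rewrite ger0_norm.
move=> /cvgrPdist_lt /(_ e e0)[N _ /(_ N (leqnn N))] /=.
rewrite sub0r normrN ger0_norm ?exprn_ge0// => /ltW h.
by exists N.
Qed.

Lemma first_crossing (z t e : R) : 0 < z -> z < 1 -> 0 < e -> e < t ->
  exists2 n, e < t * z ^+ n & t * z ^+ n.+1 <= e.
Proof.
move=> z0 z1 e0 et.
have t0 : 0 < t := lt_trans e0 et.
have ex : exists n, t * z ^+ n <= e.
  have [n nle] := exprn_small (ltW z0) z1 (divr_gt0 e0 t0).
  by exists n; rewrite mulrC -ler_pdivlMr.
case: (ex_minnP ex) => -[|n] ne nmin; first by rewrite mulr1 leNgt et in ne.
exists n => //; rewrite ltNge; apply/negP => /nmin; by rewrite ltnn.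
Qed.

Lemma incommensurable_not_evenly_spread K c : 0 < c ->
  incommensurable alpha (1 - alpha) ->
  ~ forall S, exists u s l,
    [/\ S <= s, subdivided alpha u s l & evenly_spread K c u l].
Proof.
move=> c0 inc H; set b : R := 1 - alpha.
have b0 : 0 < b by [].
have b1 : b < 1 by rewrite gtrBl.
(* Two deviations account for [2 * K] and the change of [c] times the length for at most 1, so a
   jump larger than [n] is a contradiction. The length [th] below is where the count jumps by more
   than [n]. *)
pose n := (Num.truncn (2 * K + 1)).+1.
have nK : 2 * K + 1 < n%:R by exact: truncnS_gt.
pose th := (alpha * b ^+ n)^-1.
have bn0 : 0 < b ^+ n by rewrite exprn_gt0.
have bn1 : b ^+ n <= 1 by rewrite exprn_ile1// ltW.
have ab0 : 0 < alpha * b ^+ n by rewrite mulr_gt0.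
have th1 : 1 < th by rewrite invf_gt1//; apply: le_lt_trans alpha_lt1;
  rewrite ler_piMr// ltW.
have th0 : 0 < th by rewrite invr_gt0.
(* The first term keeps the two lengths around [th] within [c^-1] of each other, as the larger is at
   most [th / b]; the second keeps the smaller one above 1. *)
pose dl := Num.min (b / (th * c)) (1 - th^-1).
have dl0 : 0 < dl.
  by rewrite lt_min divr_gt0 ?mulr_gt0//= subr_gt0 invf_lt1.
have [m1 [n1 [m2 [n2]]]] := inc dl dl0; rewrite -/b.
set z := _ / _; move=> /andP[zd z1].
pose y := alpha ^+ m2 * b ^+ n2; have y0 : 0 < y by rewrite mulr_gt0 ?exprn_gt0.
have z0 : 0 < z by rewrite divr_gt0// mulr_gt0 ?exprn_gt0.
(* At most [W] factors [z] bring a length from [(th, th / b]] down to [th]. Each factor trades one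
   [y] for [alpha ^+ m1 * b ^+ n1], so starting from [y ^+ W] the exponents stay natural and the
   lengths belong to subtiles of the same interval. *)
have [W zW] := exprn_small (ltW z0) z1 b0.
have yW0 : 0 < y ^+ W by rewrite exprn_gt0.
have [u [s [l [Ss d g]]]] := H (th / y ^+ W + 1).
have hs0 : th < s * y ^+ W.
  rewrite -ltr_pdivrMr//; apply: lt_le_trans Ss; lra.
have [J Jgt Jle] := first_crossing b0 b1 th0 hs0.
set t0 := s * y ^+ W * b ^+ J in Jgt.
have t0b : t0 * b <= th by rewrite /t0 -[_ * b]mulrA -exprSr.
have t00 : 0 < t0 := lt_trans th0 Jgt.
have [w wgt wle] := first_crossing z0 z1 th0 Jgt.
have wW : (w < W)%N.
  rewrite ltnNge; apply/negP => Ww.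
  have : t0 * z ^+ w <= t0 * b.
    rewrite ler_pM2l//; apply: le_trans zW.
    by rewrite ler_wiXn2l// ltW.
  by move=> /(lt_le_trans wgt) /lt_le_trans /(_ t0b); rewrite ltxx.
have node k : (k <= W)%N -> 1 < t0 * z ^+ k -> exists u' l',
    subdivided alpha u' (t0 * z ^+ k) l' /\ evenly_spread K c u' l'.
  move=> kW; have -> : t0 * z ^+ k =
    alpha ^+ (m1 * k + m2 * (W - k)) * b ^+ (n1 * k + n2 * (W - k) + J) * s.
    rewrite /t0 /z expr_div_n -/y -[in y ^+ W](subnKC kW) [y ^+ (k + _)]exprD.
    rewrite [y ^+ (W - k)]exprMn !exprMn -!exprM !exprD.
    by field; rewrite !expf_neq0 ?gt_eqF.
  by move=> h; have := subdivided_descend alpha_gt0 alpha_lt1 d g h.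
have dl1 : th^-1 <= 1 - dl.
  have : dl <= 1 - th^-1 by rewrite ge_min lexx orbT.
  by move=> h; lra.
have zth : 1 <= th * (1 - dl).
  by have h := dl1; rewrite -(ler_pM2l th0) mulfV ?gt_eqF// in h.
have s1gt : 1 < t0 * z ^+ w.+1.
  rewrite exprSr mulrA; apply: le_lt_trans zth _.
  have ? : 0 <= 1 - dl by apply: le_trans dl1; rewrite invr_ge0 ltW.
  by rewrite ltr_pM// ltW.
have [u1 [l1 [d1 g1]]] := node w.+1 wW s1gt.
have [u2 [l2 [d2 g2]]] := node w (ltnW wW) (lt_trans th1 wgt).
set s1 := t0 * z ^+ w.+1 in wle d1 s1gt.
set s2 := t0 * z ^+ w in wgt d2.
have jump : (size l1 + n < size l2)%N.
  apply: (subdivided_size_jump d1 d2); rewrite -/b.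
    by rewrite -ler_pdivlMl// mulr1.
  by rewrite -ltr_pdivrMl// mulr1.
have h1 := evenly_spread_size d1 g1; have h2 := evenly_spread_size d2 g2.
have s12 : c * (s2 - s1) <= 1.
  have s2le : s2 <= th / b.
    rewrite ler_pdivlMr//; apply: le_trans t0b; rewrite ler_pM2r//.
    by rewrite /s2 ler_piMr ?(ltW t00)// exprn_ile1// ltW.
  have -> : s2 - s1 = s2 * (1 - z) by rewrite /s1 /s2 exprSr; ring.
  have hz : 1 - z <= b / (th * c).
    have : dl <= b / (th * c) by rewrite ge_min lexx.
    by move=> ?; lra.
  have : s2 * (1 - z) <= th / b * (b / (th * c)).
    apply: ler_pM => //; first exact: le_trans (ltW th0) (ltW wgt).
    by rewrite subr_ge0 ltW.
  have -> : th / b * (b / (th * c)) = c^-1 by field; rewrite !gt_eqF.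
  by move=> h; rewrite -(ler_pM2l c0) mulfV ?gt_eqF// in h.
have jR : (size l1)%:R + n%:R < (size l2)%:R :> R by rewrite -natrD ltr_nat.
move: h1 h2; rewrite !ler_norml => /andP[h11 h12] /andP[h21 h22].
by lra.
Qed.
End Incommensurable.

(** * Commensurable ratios *)

Lemma coprime_semigroup p q n : (0 < p)%N -> (0 < q)%N -> coprime p q ->
  (p * q <= n)%N -> exists i j, n = (i * p + j * q)%N.
Proof.
move=> p0 q0 copq pqn.
pose m := (chinese p q 0 n %% (p * q))%N.
have mp : (p %| m)%N.
  by rewrite /dvdn /m modn_dvdm ?dvdn_mulr// chinese_modl// mod0n.
have mq : m = n %[mod q] by rewrite /m modn_dvdm ?dvdn_mull// chinese_modr.
have mn : (m <= n)%N.
  by apply: leq_trans pqn; rewrite ltnW// ltn_mod muln_gt0 p0.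
have nq : (q %| n - m)%N by rewrite -eqn_mod_dvd// mq.
exists (m %/ p)%N, ((n - m) %/ q)%N.
by rewrite !divnK// subnKC.
Qed.

Section Commensurable.
Variable R : realType.
Variables (alpha x : R) (p q : nat).
Hypotheses (x_gt0 : 0 < x) (x_lt1 : x < 1) (p_gt0 : (0 < p)%N) (q_gt0 : (0 <
  q)%N).
Hypotheses (alphaE : alpha = x ^+ p) (calphaE : 1 - alpha = x ^+ q).
Implicit Types (u s c K sigma : R) (l : seq R).

Let alpha_gt0 : 0 < alpha. Proof. by rewrite alphaE exprn_gt0. Qed.

Let alpha_lt1 : alpha < 1. Proof. by rewrite -subr_gt0 calphaE exprn_gt0. Qed.

(* [s] is [sigma * x ^- k], except that all lengths at most 1 have level 0. *)
Definition at_level sigma s k :=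
  [/\ (0 < k)%N & s = sigma * x ^- k] \/ k = 0%N /\ s <= 1.

Lemma at_level_gt1 sigma s k : x < sigma -> at_level sigma s k ->
  (1 < s) = (0 < k)%N.
Proof.
move=> xs [[k0 ->]|[-> s1]]; last by rewrite ltNge s1.
rewrite k0; case: k k0 => // k _.
rewrite ltr_pdivlMr ?exprn_gt0// mul1r exprS; apply: le_lt_trans xs.
by rewrite ler_piMr ?(ltW x_gt0)// exprn_ile1// ltW.
Qed.

Lemma at_level_child sigma s k r : 0 < sigma <= 1 -> (0 < k)%N ->
  at_level sigma s k -> at_level sigma (x ^+ r * s) (k - r).
Proof.
move=> /andP[s0 s1] k0 [[_ ->]|[k0' _]]; last by rewrite k0' in k0.
have [rk|kr] := ltnP r k.
  left; split; first by rewrite subn_gt0.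
  rewrite -{1}(subnKC (ltnW rk)) exprD mulrCA invfM; congr (_ * _).
  by rewrite mulrA mulfV ?mul1r// expf_neq0// gt_eqF.
right; split; first by apply/eqP.
have -> : x ^+ r * (sigma * x ^- k) = sigma * x ^+ (r - k).
  rewrite -[in LHS](subnKC kr) exprD; field.
  by rewrite expf_neq0// gt_eqF.
by rewrite mulr_ile1// ?(ltW s0) ?exprn_ge0 ?exprn_ile1 ?(ltW x_gt0)
  ?(ltW x_lt1).
Qed.

Lemma at_level_exists s : exists sigma k,
  [/\ x < sigma, sigma <= 1 & at_level sigma s k].
Proof.
have [s1|s1] := leP s 1; first by exists 1, 0%N; split => //; right.
have [n n1 n2] := first_crossing x_gt0 x_lt1 ltr01 s1.
exists (s * x ^+ n.+1), n.+1; split => //.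
  by rewrite exprSr mulrA ltr_pMl.
by left; split => //; rewrite mulfK// expf_neq0// gt_eqF.
Qed.

Lemma subdivided_level_count u s l sigma k : x < sigma -> sigma <= 1 ->
  subdivided alpha u s l -> at_level sigma s k -> size l = level_count p q k.
Proof.
move=> xs s1 d; have s01 : 0 < sigma <= 1 by rewrite (lt_trans x_gt0).
elim: d k => {u s l} [u s _ sle1 k lk|u s l1 l2 sgt1 _ IH1 _ IH2 k lk].
  have := at_level_gt1 xs lk; rewrite ltNge sle1/= => /esym/negbT.
  by rewrite lt0n negbK => /eqP ->.
have k0 : (0 < k)%N by rewrite -(at_level_gt1 xs lk).
rewrite size_cat level_countE// (IH1 (k - p)%N) ?(IH2 (k - q)%N)//.
  by rewrite calphaE; exact: at_level_child.
by rewrite alphaE; exact: at_level_child.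
Qed.

(** Only [K] and [c1] are uniform; the density [C / sigma] depends on the interval. Tiles left of a
    breakpoint group into the left children skipped at right turns of a path down the tree, and
    their deviations form a geometric series. *)
Lemma decaying_deviation_evenly_spread : decaying_deviation x (level_count p q)
  ->
  exists K c1 : R, forall u s l, subdivided alpha u s l ->
    exists c, 0 < c <= c1 /\ evenly_spread K c u l.
Proof.
move=> [C [D [kap [C0 D0 /andP[kap0 kap1] dev]]]].
pose c1 := C / x; have c10 : 0 < c1 by rewrite divr_gt0.
(* The part [1 + c1] covers leaves, whose length is only known to be at most 1. [G] is such that the
   cost [E * kap ^+ (k - p)] of a skipped left child is at most [G * (kap ^+ (k - q) - kap ^+ k)],
   so that [E + G * (1 - kap ^+ k)] is an inductive bound at level [k]. *)
pose E := D + 1 + c1; have E0 : 0 < E by rewrite /E; lra.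
pose G := E / kap ^+ p / (1 - kap).
have G0 : 0 < G by rewrite !divr_gt0 ?exprn_gt0// subr_gt0.
exists (2 * (E + G)), c1 => u s l d.
have [sigma [k [xs s1 lk]]] := at_level_exists s.
have s0 : 0 < sigma := lt_trans x_gt0 xs.
have s01 : 0 < sigma <= 1 by rewrite s0.
pose c := C / sigma; have c0 : 0 < c by rewrite divr_gt0.
have cc1 : c <= c1 by rewrite ler_pM2l// lef_pV2 ?posrE// ltW.
have devE u' s' l' k' : subdivided alpha u' s' l' -> at_level sigma s' k' ->
    `|(size l')%:R - c * s'| <= E * kap ^+ k'.
  move=> d' lk'; have sz := subdivided_level_count xs s1 d' lk'.
  case: lk' sz => [[k'0 ->] ->|[-> s'1] ->].
    rewrite /c mulrA divfK ?gt_eqF//; apply: le_trans (dev k') _.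
    by rewrite ler_wpM2r ?exprn_ge0 ?(ltW kap0)// /E; lra.
  rewrite level_count0 expr0 mulr1 /E; apply: le_trans (ler_normB _ _) _.
  rewrite normr1 normrM (gtr0_norm c0) (gtr0_norm (subdivided_gt0 d')).
  have := subdivided_gt0 d'; move: c0 cc1 s'1 D0; nra.
have bound u' s' l' k' : subdivided alpha u' s' l' -> at_level sigma s' k' ->
    forall m, (m <= size l')%N ->
    `|m%:R - c * (breakpoint u' l' m - u')| <= E + G * (1 - kap ^+ k').
  move=> d'; elim: d' k' => {u' s' l'} [u' s' s'0 s'1 k' lk' m|].
    have k'0 : 0 <= G * (1 - kap ^+ k').
      by rewrite mulr_ge0 ?(ltW G0)// subr_ge0 exprn_ile1// ltW.
    case: m => [|[|//]] _.
      by rewrite /breakpoint/= !subrr mulr0 subrr normr0 addr_ge0// ltW.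
    rewrite /breakpoint/= addrAC subrr add0r.
    apply: le_trans (ler_normB _ _) _.
    rewrite normr1 normrM (gtr0_norm c0) (gtr0_norm s'0) /E.
    by move: c0 cc1 s'1 s'0 D0 k'0; nra.
  move=> u' s' l1 l2 s'1 d1 IH1 d2 IH2 k' lk' m.
  have k'0 : (0 < k')%N by rewrite -(at_level_gt1 xs lk').
  have lk1 : at_level sigma (alpha * s') (k' - p).
    by rewrite alphaE; exact: at_level_child.
  have lk2 : at_level sigma ((1 - alpha) * s') (k' - q).
    by rewrite calphaE; exact: at_level_child.
  have kapX i j : (i <= j)%N -> kap ^+ j <= kap ^+ i.
    by move=> ij; rewrite ler_wiXn2l// ltW.
  have [m1 _|m1 ml] := leqP m (size l1).
    rewrite breakpoint_catl//; apply: le_trans (IH1 _ lk1 m m1) _.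
    by rewrite lerD2l ler_pM2l// lerD2l lerN2 kapX// leq_subr.
  have m2 : (m - size l1 <= size l2)%N by rewrite leq_subLR -size_cat.
  have h1 := devE _ _ _ _ d1 lk1; have h2 := IH2 _ lk2 _ m2.
  rewrite -(subnKC (ltnW m1)) (breakpointDr _ _ d1) natrD.
  set b := breakpoint _ _ _ in h2 *; set j := (m - size l1)%:R in h2 *.
  rewrite (_ : _ - _ = ((size l1)%:R - c * (alpha * s')) +
    (j - c * (b - (u' + alpha * s')))); last by ring.
  apply: le_trans (ler_normD _ _) _; apply: le_trans (lerD h1 h2) _.
  have G1 : E * kap ^+ (k' - p) <= G * (kap ^+ (k' - q) - kap ^+ k').
    have e1 : kap ^+ (k'.-1) * (1 - kap) <= kap ^+ (k' - q) - kap ^+ k'.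
      have -> : kap ^+ k' = kap ^+ k'.-1 * kap by rewrite -exprSr prednK.
      by rewrite mulrBr mulr1 lerD2r kapX// -subn1 leq_sub2l.
    apply: le_trans (_ : G * (kap ^+ (k'.-1) * (1 - kap)) <= _); last first.
      by rewrite ler_pM2l.
    have -> : G * (kap ^+ k'.-1 * (1 - kap)) = E * (kap ^+ k'.-1 / kap ^+ p).
      by rewrite /G; field; rewrite expf_neq0 ?gt_eqF// subr_gt0.
    rewrite ler_pM2l// ler_pdivlMr ?exprn_gt0// -exprD kapX//.
    by apply: leq_trans (leq_pred _) _; rewrite addnC -leq_subLR.
  by move: G1; lra.
exists c; split; first by rewrite c0.
move=> m n _ mn nl.
have h1 := bound _ _ _ _ d lk n nl.
have h2 := bound _ _ _ _ d lk m (leq_trans mn nl).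
have h3 : E + G * (1 - kap ^+ k) <= E + G.
  by rewrite lerD2l ler_piMr ?(ltW G0)// gerBl exprn_ge0// ltW.
move: h1 h2; rewrite !ler_norml => /andP[h11 h12] /andP[h21 h22].
by apply/andP; split; lra.
Qed.

(** Every number from [p * q] on is a combination of [p] and [q], so all positive levels at least
    [p * q] below [L] occur among the subtiles, with the same [sigma]. *)
Lemma level_reachable K c u s l sigma L k : coprime p q ->
  x < sigma -> sigma <= 1 -> (0 < L)%N -> s = sigma * x ^- L ->
  subdivided alpha u s l -> evenly_spread K c u l ->
  (0 < k)%N -> (k + p * q <= L)%N ->
  `|(level_count p q k)%:R - c * sigma * x ^- k| <= K.
Proof.
move=> copq xs s1 L0 sE d g k0 kL.
have [|i [j ijE]] := coprime_semigroup p_gt0 q_gt0 copq (_ : p * q <= L - k)%N.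
  by lia.
have s'E : alpha ^+ i * (1 - alpha) ^+ j * s = sigma * x ^- k.
  rewrite calphaE alphaE -!exprM -exprD [(p * i)%N]mulnC [(q * j)%N]mulnC -ijE
    sE.
  rewrite -[in x ^- L](subnKC (_ : k <= L)%N); last by lia.
  by rewrite exprD; field; rewrite !expf_neq0 ?gt_eqF.
have lk : at_level sigma (sigma * x ^- k) k by left.
have := subdivided_descend (m := i) (n := j) alpha_gt0 alpha_lt1 d g.
rewrite s'E (at_level_gt1 xs lk) => /(_ k0)[u' [l' [d' g']]].
have := evenly_spread_size d' g'.
by rewrite (subdivided_level_count xs s1 d' lk) mulrA.
Qed.

Lemma large_level s sigma M : sigma <= 1 -> 0 < sigma -> x ^- M < s ->
  (exists k, at_level sigma s k) -> 
  exists2 L, (M < L)%N & s = sigma * x ^- L.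
Proof.
move=> s1 s0 Ms [L [[L0 sE]|[_ sle1]]]; last first.
  have : 1 <= x ^- M.
    by rewrite invf_ge1 ?exprn_gt0// exprn_ile1// ltW.
  by move=> /le_lt_trans /(_ Ms); rewrite ltNge sle1.
exists L => //; rewrite ltnNge; apply/negP => LM.
have : s <= x ^- M.
  rewrite sE; apply: (@le_trans _ _ (x ^- L)).
    by rewrite ler_piMl// invr_ge0 exprn_ge0// ltW.
  by rewrite lef_pV2 ?posrE ?exprn_gt0// ler_wiXn2l// ltW.
by rewrite leNgt Ms.
Qed.

(** Consecutive levels inside one interval share [c * sigma], and subtracting [x^-1] times one
    deviation from the next removes this number, which may change with the interval. The remaining
    bound is uniform in the level. *)
Lemma commensurable_not_evenly_spread K c : coprime p q -> (6 < p + q)%N ->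
  ~ forall S, exists u s l,
    [/\ S <= s, subdivided alpha u s l & evenly_spread K c u l].
Proof.
move=> copq pq6 H.
have xV0 : 0 < x^-1 by rewrite invr_gt0.
have bdd k : `|(level_count p q k.+2)%:R - x^-1 * (level_count p q k.+1)%:R|
    <= K * (1 + x^-1).
  have [u [s [l [Ss d g]]]] := H (x ^- (k.+2 + p * q) + 1).
  have [sigma [k0 [xs s1 lk]]] := at_level_exists s.
  have [||L ML sE] := @large_level s sigma (k.+2 + p * q) s1 (lt_trans x_gt0
    xs).
  - by lra.
  - by exists k0.
  have L0 : (0 < L)%N by exact: leq_ltn_trans ML.
  have h2 := level_reachable copq xs s1 L0 sE d g (ltn0Sn k.+1) (ltnW ML).
  have h1 : `|(level_count p q k.+1)%:R - c * sigma * x ^- k.+1| <= K.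
    by apply: (level_reachable copq xs s1 L0 sE d g (ltn0Sn k)); move: ML;
      clear; lia.
  set a1 : R := (level_count p q k.+1)%:R in h1 *.
  set a2 : R := (level_count p q k.+2)%:R in h2 *.
  have -> : a2 - x^-1 * a1 = (a2 - c * sigma * x ^- k.+2) -
      x^-1 * (a1 - c * sigma * x ^- k.+1).
    by rewrite -!exprVn [x^-1 ^+ k.+2]exprS; ring.
  apply: le_trans (ler_normB _ _) _; rewrite normrM (gtr0_norm xV0).
  by rewrite mulrDr mulr1 lerD// mulrC ler_pM2r.
have [qp|pq] := ltnP q p.
  by apply: level_count_ratio_unbounded bdd => //; rewrite q_gt0.
have {pq}pq : (p < q)%N.
  rewrite ltn_neqAle pq andbT; apply/eqP => pqE.
  by move: copq pq6; rewrite -pqE /coprime gcdnn => /eqP ->.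
have copq' : coprime q p by rewrite coprime_sym.
apply: (@level_count_ratio_unbounded _ q p x (K * (1 + x^-1))) => //.
- by rewrite p_gt0.
- by rewrite addnC.
- by move=> k; rewrite !(level_countC _ q_gt0 p_gt0).
Qed.
End Commensurable.

(** * Accumulated deviations for the exponents 5 and 1 *)

Section FiveOne.
Variable R : realType.
Variables (alpha x sigma c : R).
Hypotheses (x_gt0 : 0 < x) (x_lt1 : x < 1) (xs : x < sigma) (sigma_le1 : sigma
  <= 1).
Implicit Types (u s K eps : R) (l : seq R).

Let e k : R := (level_count 5 1 k)%:R - c * sigma * x ^- k.

Let sigma01 : 0 < sigma <= 1. Proof. by rewrite (lt_trans x_gt0). Qed.

(* Every fifth level can be collected or skipped independently along a path that
   stays at the end of the long subtiles: skipping moves to the long subtile and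
   collecting a long subtile moves to the short one. *)
Lemma prefix_collects eps k n L u s l : alpha = x -> 1 - alpha = x ^+ 5 ->
  (0 < k)%N -> (n == 0)%N || (k + 5 * n <= L + 4)%N ->
  subdivided alpha u s l -> at_level x sigma s L ->
  exists2 m, (m <= size l)%N &
    \sum_(j < n) Num.max 0 (eps * e (k + 5 * j)) <=
    eps * (m%:R - c * (breakpoint u l m - u)).
Proof.
move=> aE caE k0; have aE1 : alpha = x ^+ 1 by rewrite expr1.
elim: n L u s l => [|n IHn] L u s l.
  by move=> _ d lk; exists 0%N =>
    //; rewrite big_ord0 /breakpoint /= !subrr mulr0 subrr mulr0.
rewrite /=; elim: L u s l => [|L IHL] u s l; first by lia.
move=> kL d lk.
have s1 : 1 < s by rewrite (at_level_gt1 x_gt0 x_lt1 xs lk).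
case: d s1 lk => {u s l} [u s _ s1'|u s l1 l2 _ d1 d2] s1 lk.
  by rewrite ltNge s1' in s1.
have lk1 : at_level x sigma (alpha * s) L.
  by have := at_level_child x_gt0 x_lt1 1 sigma01 (ltn0Sn L) lk;
    rewrite subn1 -aE1.
have lk2 : at_level x sigma ((1 - alpha) * s) (L.+1 - 5).
  by rewrite caE; exact: at_level_child.
have left_child N : (exists2 m, (m <= size l1)%N & N <=
    eps * (m%:R - c * (breakpoint u l1 m - u))) ->
  exists2 m, (m <= size (l1 ++ l2))%N & N <=
    eps * (m%:R - c * (breakpoint u (l1 ++ l2) m - u)).
  move=> [m ml h]; exists m; first by rewrite size_cat (leq_trans ml)//
    leq_addr.
  by rewrite breakpoint_catl.
have [kL'|kL'] := leqP (k + 5 * n.+1) (L + 4).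
  by apply: left_child; apply: IHL d1 lk1.
(* The long child now has exactly the level of the last term, and either child still has room for
   the other [n] terms. *)
have LE : L = (k + 5 * n)%N by move: kL kL'; clear; lia.
rewrite big_ord_recr /= -LE.
have [epos|eneg] := leP 0 (eps * e L); last first.
  rewrite addr0; apply: left_child; apply: IHn d1 lk1.
  by apply/orP; right; rewrite LE leq_addr.
have [|m ml hm] := IHn _ _ _ _ _ d2 lk2.
  by rewrite LE; case: (n) => //= n'; clear; lia.
exists (size l1 + m)%N; first by rewrite size_cat leq_add2l.
have L0 : (0 < L)%N by rewrite LE addn_gt0 k0.
have sz := subdivided_level_count x_gt0 x_lt1 (ltn0Sn 0) (ltn0Sn 4) aE1 caE xs
  sigma_le1 d1 lk1.
have eE : e L = (size l1)%:R - c * (alpha * s).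
  case: lk1 => [[_ ->]|[L00 _]]; last by rewrite L00 in L0.
  by rewrite sz /e (level_countC _ (ltn0Sn 4) (ltn0Sn 0)) mulrA.
rewrite (breakpointDr _ _ d1) natrD.
apply: le_trans (lerD hm (lexx _)) _.
by rewrite eE le_eqVlt; apply/orP; left; apply/eqP; ring.
Qed.

(** Mirror image of [prefix_collects]: the long child is on the right, so the collected run ends at
    the last tile. *)
Lemma suffix_collects eps k n L u s l : alpha = x ^+ 5 -> 1 - alpha = x ->
  (0 < k)%N -> (n == 0)%N || (k + 5 * n <= L + 4)%N ->
  subdivided alpha u s l -> at_level x sigma s L ->
  exists2 m, (m <= size l)%N &
    \sum_(j < n) Num.max 0 (eps * e (k + 5 * j)) <=
    eps * ((size l)%:R - m%:R - c * (u + s - breakpoint u l m)).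
Proof.
move=> aE caE k0; have caE1 : 1 - alpha = x ^+ 1 by rewrite expr1.
elim: n L u s l => [|n IHn] L u s l.
  move=> _ d lk; exists (size l) => //; rewrite big_ord0.
  by rewrite breakpoint_last (subdivided_last d) !subrr mulr0 subrr mulr0.
rewrite /=; elim: L u s l => [|L IHL] u s l; first by lia.
move=> kL d lk.
have s1 : 1 < s by rewrite (at_level_gt1 x_gt0 x_lt1 xs lk).
case: d s1 lk => {u s l} [u s _ s1'|u s l1 l2 _ d1 d2] s1 lk.
  by rewrite ltNge s1' in s1.
have lk2 : at_level x sigma ((1 - alpha) * s) L.
  by have := at_level_child x_gt0 x_lt1 1 sigma01 (ltn0Sn L) lk;
    rewrite subn1 -caE1.
have lk1 : at_level x sigma (alpha * s) (L.+1 - 5).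
  by rewrite aE; exact: at_level_child.
have right_child N : (exists2 m, (m <= size l2)%N & N <=
    eps * ((size l2)%:R - m%:R -
      c * (u + alpha * s + (1 - alpha) * s - breakpoint (u + alpha * s) l2 m)))
        ->
  exists2 m, (m <= size (l1 ++ l2))%N & N <=
    eps * ((size (l1 ++ l2))%:R - m%:R - c * (u + s - breakpoint u (l1 ++ l2)
      m)).
  move=> [m ml h]; exists (size l1 + m)%N; first by rewrite size_cat leq_add2l.
  rewrite (breakpointDr _ _ d1) size_cat !natrD; apply: le_trans h _.
  by rewrite le_eqVlt; apply/orP; left; apply/eqP; ring.
have [kL'|kL'] := leqP (k + 5 * n.+1) (L + 4).
  by apply: right_child; apply: IHL d2 lk2.
have LE : L = (k + 5 * n)%N by move: kL kL'; clear; lia.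
rewrite big_ord_recr /= -LE.
have [epos|eneg] := leP 0 (eps * e L); last first.
  rewrite addr0; apply: right_child; apply: IHn d2 lk2.
  by apply/orP; right; rewrite LE leq_addr.
have [|m ml hm] := IHn _ _ _ _ _ d1 lk1.
  by rewrite LE; case: (n) => //= n'; clear; lia.
exists m; first by rewrite size_cat (leq_trans ml)// leq_addr.
have L0 : (0 < L)%N by rewrite LE addn_gt0 k0.
have sz := subdivided_level_count x_gt0 x_lt1 (ltn0Sn 4) (ltn0Sn 0) aE caE1 xs
  sigma_le1 d2 lk2.
have eE : e L = (size l2)%:R - c * ((1 - alpha) * s).
  case: lk2 => [[_ ->]|[L00 _]]; last by rewrite L00 in L0.
  by rewrite sz /e mulrA.
rewrite breakpoint_catl// size_cat natrD.
apply: le_trans (lerD hm (lexx _)) _.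
by rewrite eE le_eqVlt; apply/orP; left; apply/eqP; ring.
Qed.

(** An absolute value is the sum of the positive parts for [eps = 1] and [eps = -1]; with five
    residue classes modulo 5 this gives the factor 10. *)
Lemma collected_sum K n : 
  (forall eps k, (0 < k <= 5)%N -> `|eps| = 1 ->
     \sum_(j < n) Num.max 0 (eps * e (k + 5 * j)) <= K) ->
  \sum_(i < 5 * n) `|e i.+1| <= 10 * K.
Proof.
move=> H.
have abs k : (0 < k <= 5)%N -> \sum_(j < n) `|e (k + 5 * j)| <= 2 * K.
  move=> k5; have h1 := H 1 k k5 (normr1 _).
  have h2 := H (-1) k k5 (normrN1 _).
  rewrite (_ : \sum_(j < n) `|e (k + 5 * j)| =
    \sum_(j < n) Num.max 0 (1 * e (k + 5 * j)) +
    \sum_(j < n) Num.max 0 (-1 * e (k + 5 * j))); first by lra.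
  rewrite -big_split; apply: eq_bigr => j _ /=.
  rewrite mul1r mulN1r; have [e0|e0] := leP 0 (e (k + 5 * j)).
    by rewrite ger0_norm// (max_l (_ : - e _ <= 0)) ?oppr_le0// addr0.
  by rewrite ltr0_norm// (max_r (_ : 0 <= - e _)) ?add0r// oppr_ge0 ltW.
suff -> : \sum_(i < 5 * n) `|e i.+1| = \sum_(k < 5) \sum_(j < n) `|e (k.+1 + 5
  * j)|.
  apply: (@le_trans _ _ (\sum_(k < 5) 2 * K)).
    by apply: ler_sum => k _; apply: abs; rewrite ltn_ord.
  by rewrite sumr_const card_ord -mulr_natl; lra.
rewrite exchange_big /=; elim: n {H abs} => [|n IH];
  first by rewrite muln0 !big_ord0.
rewrite mulnS addnC big_split_ord /= IH [in RHS]big_ord_recr /=; congr (_ + _).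
by apply: eq_bigr => k _; rewrite addSn addnC.
Qed.

End FiveOne.

Section FiveOneTree.
Variable R : realType.
Variables (alpha x : R).
Hypotheses (x_gt0 : 0 < x) (x_lt1 : x < 1).

Lemma commensurable51_not_evenly_spread K c :
  alpha = x /\ 1 - alpha = x ^+ 5 \/ alpha = x ^+ 5 /\ 1 - alpha = x ->
  ~ forall S, exists u s l,
    [/\ S <= s, subdivided alpha u s l & evenly_spread K c u l].
Proof.
move=> aE H; apply: (@level_count51_not_summable R x (10 * K)) => // M.
have [u [s [l [Ss d g]]]] := H (x ^- (5 * M + 5) + 1).
have [sigma [k0 [xs s1 lk]]] := at_level_exists x_gt0 x_lt1 s.
have [||L ML sE] := @large_level R x x_gt0 x_lt1 s sigma (5 * M + 5) s1
  (lt_trans x_gt0 xs).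
- by lra.
- by exists k0.
have lkL : at_level x sigma s L by left; split => //; apply: leq_ltn_trans ML.
exists (c * sigma).
set e := fun i => (level_count 5 1 i)%:R - c * sigma * x ^- i.
have : \sum_(i < 5 * M) `|e i.+1| <= 10 * K.
  apply: collected_sum => eps k /andP[k0' k5] eps1.
  have kL : (M == 0)%N || (k + 5 * M <= L + 4)%N.
    by apply/orP; right; move: k5 ML; clear; lia.
  have epsle t : `|t| <= K -> eps * t <= K.
    by move=> tK; apply: le_trans (ler_norm _) _; rewrite normrM eps1 mul1r.
  case: aE => -[aE caE].
    have [m ml hm] := prefix_collects c x_gt0 x_lt1 xs s1 eps aE caE k0' kL d
      lkL.
    apply: le_trans hm _; apply: epsle.
    have := g 0%N m isT isT ml; rewrite /breakpoint /= subr0.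
    by [].
  have [m ml hm] := suffix_collects c x_gt0 x_lt1 xs s1 eps aE caE k0' kL d lkL.
  apply: le_trans hm _; apply: epsle.
  have := g m (size l) isT ml (leqnn _).
  by rewrite breakpoint_last (subdivided_last d).
apply: le_trans.
rewrite [leRHS](_ : _ = \sum_(i < M + 4 * M) `|e i.+1|); last first.
  by rewrite -mulSn.
rewrite big_split_ord /= -[leLHS]addr0 lerD ?sumr_ge0//.
by rewrite le_eqVlt; apply/orP; left; apply/eqP; apply: eq_bigr => i _;
  rewrite /e exprVn.
Qed.
End FiveOneTree.

(** * Tile collections and tilings *)

Section TileCollections.
Variable R : realType.
Implicit Types (T U V : R * R) (Q tau : set (R * R)) (beta y z : R).

Lemma tile_overlap Q T U : tile_collection Q -> Q T -> Q U ->
  T.1 < U.2 -> U.1 < T.2 -> T = U.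
Proof.
move=> [Qtile Qtriv] QT QU TU UT; apply: Qtriv => //.
have := Qtile _ QT; have := Qtile _ QU; rewrite /is_tile => U12 T12.
rewrite /tile_support !interior_itv.
exists ((Num.max T.1 U.1 + Num.min T.2 U.2) / 2) => /=.
rewrite !in_itv /=.
have m1 : T.1 <= Num.max T.1 U.1 by rewrite le_max lexx.
have m2 : U.1 <= Num.max T.1 U.1 by rewrite le_max lexx orbT.
have m3 : Num.min T.2 U.2 <= T.2 by rewrite ge_min lexx.
have m4 : Num.min T.2 U.2 <= U.2 by rewrite ge_min lexx orbT.
have m5 : Num.max T.1 U.1 < Num.min T.2 U.2.
  by rewrite gt_max !lt_min T12 TU UT U12.
by split; apply/andP; split; lra.
Qed.

Lemma endpoints_fst Q T : Q T -> endpoints Q T.1.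
Proof. by move=> QT; left; exists T. Qed.

Lemma endpoints_snd Q T : Q T -> endpoints Q T.2.
Proof. by move=> QT; right; exists T. Qed.

Lemma endpoints_cover Q y : tile_collection Q -> endpoints Q y ->
  (\bigcup_(T in Q) tile_support T) y.
Proof.
move=> [Qtile _] [[T QT <-]|[T QT <-]]; exists T => //;
  rewrite /tile_support /= in_itv /= lexx ?andbT ltW//; exact: Qtile.
Qed.

Lemma endpoints_not_inside Q U y : tile_collection Q -> Q U ->
  endpoints Q y -> y <= U.1 \/ U.2 <= y.
Proof.
move=> CQ QU ey; have [|yU] := leP y U.1; first by left.
have [|Uy] := leP U.2 y; first by right.
have [Qtile _] := CQ.
case: ey yU Uy => -[V QV <-] VU UV; have := Qtile _ QV; rewrite /is_tile => V12.
  by have := VU; rewrite (tile_overlap CQ QV QU UV (lt_trans VU V12)) ltxx.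
by have := UV; rewrite (tile_overlap CQ QV QU (lt_trans V12 UV) VU) ltxx.
Qed.

Section Neighbours.
Variables (Q : set (R * R)) (beta : R).
Hypotheses (CQ : tile_collection Q) (beta_gt0 : 0 < beta).
Hypothesis lenQ : forall T, Q T -> beta <= tile_length T.
Hypothesis intQ : is_interval (\bigcup_(T in Q) tile_support T).

(** The tile over a point just to the right of [y] must start at [y]: otherwise the gap before it,
    shorter than [beta], would contain a tile. *)
Lemma next_tile y y' : endpoints Q y -> endpoints Q y' -> y < y' ->
  exists U, [/\ Q U, U.1 = y & U.2 <= y'].
Proof.
move=> ey ey' yy'.
suff [U QU Uy] : exists2 U, Q U & U.1 = y.
  exists U; split => //; have [|//] := endpoints_not_inside CQ QU ey'.
  by rewrite Uy leNgt yy'.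
pose dl := Num.min beta (y' - y) / 2.
have m0 : 0 < Num.min beta (y' - y) by rewrite lt_min beta_gt0 subr_gt0.
have m1 : Num.min beta (y' - y) <= beta by rewrite ge_min lexx.
have m2 : Num.min beta (y' - y) <= y' - y by rewrite ge_min lexx orbT.
have cov z : y <= z <= y' -> exists2 U, Q U & U.1 <= z <= U.2.
  move=> yz; have [||U QU] := intQ _ _ yz; try exact: endpoints_cover.
  by rewrite /tile_support /= in_itv /=; exists U.
have [|U QU /andP[U1 U2]] := cov (y + dl).
  by rewrite /dl; apply/andP; split; lra.
have yU : y <= U.1.
  have [//|Uy] := endpoints_not_inside CQ QU ey.
  by move: m0; rewrite /dl in U2 *; lra.
have [->|Uny] := eqVneq y U.1; first by exists U.
have yU' : y < U.1 by rewrite lt_neqAle Uny.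
have [|V QV /andP[V1 V2]] := cov ((y + U.1) / 2).
  by rewrite /dl in U1; apply/andP; split; lra.
have yV : y <= V.1.
  by have [//|Vy] := endpoints_not_inside CQ QV ey; lra.
have VU : V.2 <= U.1.
  have [h|//] := endpoints_not_inside CQ QV (endpoints_fst QU); lra.
by have := lenQ QV; rewrite /tile_length /dl in U1 *; lra.
Qed.

Lemma previous_tile y y' : endpoints Q y -> endpoints Q y' -> y < y' ->
  exists U, [/\ Q U, U.2 = y' & y <= U.1].
Proof.
move=> ey ey' yy'.
have [n] : exists n : nat, y' - y < n%:R * beta.
  exists (Num.truncn ((y' - y) / beta)).+1.
  by rewrite -ltr_pdivrMr// truncnS_gt.
elim: n y ey yy' => [|n IH] y ey yy'; first by rewrite mul0r; lra.
rewrite -natr1 mulrDl mul1r => h.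
have [U [QU Uy Uy']] := next_tile ey ey' yy'.
move: Uy'; rewrite le_eqVlt => /orP[/eqP Uy'|Uy'].
  by exists U; rewrite Uy.
have lenU := lenQ QU; rewrite /tile_length Uy in lenU.
have [|V [QV Vy' UV]] := IH _ (endpoints_snd QU) Uy'; first by lra.
by exists V; split =>
  //; apply: le_trans UV; rewrite -subr_ge0 (le_trans _ lenU)// ltW.
Qed.

End Neighbours.

Section Enumeration.
Variables (tau : set (R * R)) (beta : R).
Hypotheses (tau_tiling : is_tiling tau) (beta_gt0 : 0 < beta).
Hypothesis len_tau : forall T, tau T -> beta <= tile_length T.

Let Ctau : tile_collection tau. Proof. by case: tau_tiling. Qed.

Let cover z : exists2 T, tau T & T.1 <= z <= T.2.
Proof.
have [_ e] := tau_tiling; have : [set: R] z by [].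
by rewrite -e => -[T tT]; rewrite /tile_support /= in_itv; exists T.
Qed.

Let int_tau : is_interval (\bigcup_(T in tau) tile_support T).
Proof. by case: tau_tiling => _ ->. Qed.

Let succ_tile T : tau T -> exists U, tau U /\ U.1 = T.2.
Proof.
move=> tT; have [V tV /andP[_ V2]] := cover (T.2 + 1).
have [|U [tU UT _]] := next_tile Ctau beta_gt0 len_tau int_tau
    (endpoints_snd tT) (endpoints_snd tV); last by exists U.
by lra.
Qed.

Let pred_tile T : tau T -> exists U, tau U /\ U.2 = T.1.
Proof.
move=> tT; have [V tV /andP[V1 _]] := cover (T.1 - 1).
have [|U [tU UT _]] := previous_tile Ctau beta_gt0 len_tau int_tau
    (endpoints_fst tV) (endpoints_fst tT); last by exists U.
by lra.
Qed.

(** Lengths at least [beta] make [x] unbounded in both directions, so the left end of any tile lies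
    in some [[x k, x (k + 1))], and overlapping tiles coincide. *)
Lemma tiling_enumeration : exists x : int -> R,
  (forall k, tau (x k, x (k + 1))) /\
  (forall T, tau T -> exists k, T = (x k, x (k + 1))).
Proof.
have [T0 tT0 _] := cover 0.
have /choice[next nextP] T : exists U, tau T -> tau U /\ U.1 = T.2.
  have [/succ_tile[U h]|nT] := pselect (tau T); first by exists U.
  by exists T.
have /choice[prev prevP] T : exists U, tau T -> tau U /\ U.2 = T.1.
  have [/pred_tile[U h]|nT] := pselect (tau T); first by exists U.
  by exists T.
pose S (k : int) := match k with Posz n => iter n next T0
                               | Negz n => iter n.+1 prev T0 end.
have St k : tau (S k).
  case: k => n; rewrite /S; first by elim: n => //= n /nextP[].
  by elim: n.+1 => //= m /prevP[].
have SS k : (S k).2 = (S (k + 1)).1.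
  case: k => [n|[|n]].
  - by rewrite -[(Posz n + 1)]/(Posz (n + 1)) addn1 /=;
    have [_ ->] := nextP _ (St n).
  - by rewrite NegzE addNr /=; have [_ ->] := prevP _ tT0.
  - rewrite (_ : Negz n.+1 + 1 = Negz n); last by rewrite !NegzE; lia.
    by have [_ <-] := prevP _ (St (Negz n)).
pose x k := (S k).1.
have SE k : S k = (x k, x (k + 1)) by rewrite /x -SS; case: (S k).
have step k : x k + beta <= x (k + 1).
  by have := len_tau (St k); rewrite /tile_length SE /=; lra.
exists x; split => [k|T tT]; first by rewrite -SE.
have up (n : nat) : x 0 + n%:R * beta <= x n.
  elim: n => [|n IH]; first by rewrite mul0r addr0.
  rewrite -natr1 mulrDl mul1r; have := step n.
  by rewrite -[Posz n + 1]/(Posz (n + 1)) addn1; lra.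
have down (n : nat) : x (- (n%:Z)) <= x 0 - n%:R * beta.
  elim: n => [|n IH]; first by rewrite mul0r subr0 oppr0.
  rewrite -natr1 mulrDl mul1r; have := step (- (n.+1%:Z)).
  rewrite (_ : - (n.+1)%:Z + 1 = - n%:Z); last by lia.
  by lra.
have bnd y : exists n : nat, `|y| < n%:R * beta.
  exists (Num.truncn (`|y| / beta)).+1.
  by rewrite -ltr_pdivrMr// truncnS_gt.
have [n hn] := bnd (T.1 - x 0).
have hd : x (- n%:Z) <= T.1.
  by have := down n; move: hn; rewrite ltr_norml => /andP[]; lra.
have hu : T.1 < x (- n%:Z + (n + n)%N%:Z).
  rewrite (_ : - n%:Z + _ = n%:Z); last by lia.
  by have := up n; move: hn; rewrite ltr_norml => /andP[]; lra.
have [k [k1 k2]] : exists k, x k <= T.1 /\ T.1 < x (k + 1).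
  elim: (n + n)%N hu => [|m IH]; first by rewrite addr0 ltNge hd.
  move=> hm; have [h|h] := ltP T.1 (x (- n%:Z + m%:Z)); first exact: IH.
  exists (- n%:Z + m%:Z); split => //.
  by move: hm; rewrite (_ : - n%:Z + m.+1%:Z = - n%:Z + m%:Z + 1)//; lia.
exists k; rewrite -SE; apply: (tile_overlap Ctau) => //; rewrite SE //=.
by apply: le_lt_trans k1 _; case: Ctau => h _; exact: h.
Qed.

End Enumeration.
End TileCollections.

(** * Limits of patches *)

Section Limit.
Variable R : realType.
Variable alpha : R.
Hypotheses (alpha_gt0 : 0 < alpha) (alpha_lt1 : alpha < 1).
Let beta := Num.min alpha (1 - alpha).

Let beta_gt0 : 0 < beta.
Proof. by rewrite lt_min alpha_gt0 subr_gt0. Qed.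

Let beta_le1 : beta <= 1. Proof. by rewrite ge_min ltW. Qed.

Lemma breakpoint_lt u s l i j : subdivided alpha u s l -> beta <= s ->
  (i < j)%N -> (j <= size l)%N -> breakpoint u l i < breakpoint u l j.
Proof.
move=> d bs ij jl.
have := breakpoint_le alpha_gt0 alpha_lt1 d bs ij jl.
have /andP[h _] := subdivided_tile_length alpha_gt0 alpha_lt1 d bs (leq_trans
  ij jl).
apply: lt_le_trans; rewrite -subr_gt0; exact: lt_le_trans h.
Qed.

Lemma breakpoint_inj u s l i j : subdivided alpha u s l -> beta <= s ->
  (i <= size l)%N -> (j <= size l)%N ->
  breakpoint u l i = breakpoint u l j -> i = j.
Proof.
move=> d bs il jl bij; case: (ltngtP i j) => // h.
  by have := breakpoint_lt d bs h jl; rewrite bij ltxx.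
by have := breakpoint_lt d bs h il; rewrite bij ltxx.
Qed.

Definition chain (x : nat -> R) n : set (R * R) := [set (x k, x k.+1) | k in
  `I_n].

Lemma chain_endpoints x n y : endpoints (chain x n) y ->
  exists2 k, (k <= n)%N & y = x k.
Proof.
case=> -[_ [k /= kn <-] <-]; first by exists k => //; exact: ltnW.
by exists k.+1.
Qed.

Lemma endpoints_chain x n k : (0 < n)%N -> (k <= n)%N ->
  endpoints (chain x n) (x k).
Proof.
move=> n0; rewrite leq_eqVlt => /orP[/eqP ->|kn].
  right; exists (x n.-1, x n) => //; exists n.-1; first by rewrite /= prednK.
  by rewrite prednK.
by left; exists (x k, x k.+1) => //; exists k.
Qed.

Lemma cf_dist_lt (A B : set R) (e : R) : e <= 1 -> cf_dist A B < e ->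
  exists2 d, cf_close A B d & d < e.
Proof.
move=> e1; rewrite /cf_dist; case: asboolP => [ne h|_ h].
  exact: inf_lt.
by have := lt_le_trans h e1; rewrite ltxx.
Qed.

Lemma endpoints_translate v (S : set (R * R)) :
  endpoints (translate v S) = [set y + v | y in endpoints S].
Proof.
rewrite /endpoints image_setU; congr (_ `|` _); apply/seteqP; split => y.
- by move=> [_ [T ST <-] <-] /=; exists T.1 => //; exists T.
- by move=> [_ [T ST <-] <-] /=; exists (T.1 + v, T.2 + v) => //; exists T.
- by move=> [_ [T ST <-] <-] /=; exists T.2 => //; exists T.
- by move=> [_ [T ST <-] <-] /=; exists (T.1 + v, T.2 + v) => //; exists T.
Qed.

(** Closeness of endpoint sets only matches points inside a bounded window. The point is that no
    further endpoint hides between two matched ones, so that the chain corresponds to consecutive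
    tiles of one subdivided interval. *)
Lemma limit_chain (x : nat -> R) n (g eps : R) : (0 < n)%N -> 0 < g -> 0 < eps
  ->
  (forall k, (k < n)%N -> x k + g <= x k.+1) ->
  is_limit_of_subpatches alpha (chain x n) ->
  exists u s l v i0, [/\ subdivided alpha u s l, 1 <= s, (i0 + n <= size l)%N &
    forall k, (k <= n)%N -> `|breakpoint u l (i0 + k) + v - x k| <= eps].
Proof.
move=> n0 g0 eps0 xg [Q Qsub Qlim].
have xlt i j : (i < j)%N -> (j <= n)%N -> x i < x j.
  elim: j => // j IH; rewrite ltnS leq_eqVlt => /orP[/eqP -> jn|ij jn].
    by have := xg _ jn; lra.
  by have := xg _ jn; have := IH ij (ltnW jn); lra.
have xle i j : (i <= j)%N -> (j <= n)%N -> x i <= x j.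
  by rewrite leq_eqVlt => /orP[/eqP ->//|ij jn]; apply/ltW/xlt.
pose M := Num.max `|x 0%N| `|x n|.
have M0 : 0 <= M by rewrite le_max normr_ge0.
have xM k : (k <= n)%N -> `|x k| <= M.
  move=> kn; have h1 := xle _ _ (leq0n k) kn; have h2 := xle _ _ kn (leqnn n).
  have m1 : `|x 0%N| <= M by rewrite le_max lexx.
  have m2 : `|x n| <= M by rewrite le_max lexx orbT.
  move: m1 m2; rewrite !ler_norml => /andP[m11 m12] /andP[m21 m22].
  by apply/andP; split; lra.
(* [g / 2] keeps the matched points in order, [beta / 2] excludes an endpoint between neighbours,
   and [(M + 2)^-1] makes the window contain the chain with a margin. *)
pose e0 := Num.min (Num.min eps (g / 2)) (Num.min (beta / 2) (M + 2)^-1).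
have MV0 : 0 < (M + 2)^-1 by rewrite invr_gt0; lra.
have e00 : 0 < e0.
  by rewrite !lt_min eps0 MV0 !divr_gt0.
have e0eps : e0 <= eps by rewrite !ge_min lexx.
have e0g : e0 <= g / 2 by rewrite !ge_min lexx !orbT.
have e0b : e0 <= beta / 2 by rewrite !ge_min lexx !orbT.
have e0M : e0 <= (M + 2)^-1 by rewrite !ge_min lexx !orbT.
have e01 : e0 <= 1 by apply: le_trans e0b _; rewrite ler_pdivrMr//;
  apply: le_trans beta_le1 _; rewrite mul1r ler1n.
have [m hm] : exists m, cf_dist (endpoints (Q m)) (endpoints (chain x n)) < e0.
  move: Qlim => /cvgrPdist_lt /(_ _ e00)[N _ /(_ N (leqnn N))] /=.
  by rewrite sub0r normrN => /(le_lt_trans (ler_norm _)) h; exists N.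
have [e [/andP[e_gt0 e_lt1] cQx cxQ] elt] := cf_dist_lt e01 hm.
have eM : M + 2 < e^-1.
  by rewrite -[M + 2]invrK ltf_pV2 ?posrE// (lt_le_trans elt).
have [F [S [v [[t [a [t0 _ Fpatch]]] [Spatch SF] QE]]]] := Qsub m.
have [l d Fl] := kakutani_patch_subdivided alpha_gt0 alpha_lt1 Fpatch.
set u := expR t * a in d Fl; set s := expR t in d.
have s1 : 1 <= s by rewrite /s -expR0 ler_expR.
have bs : beta <= s := le_trans beta_le1 s1.
have [_ CS intS] := Spatch.
have lenS T : S T -> beta <= tile_length T.
  move=> /SF /Fl [i il ->]; rewrite /tile_length /=.
  by have /andP[] := subdivided_tile_length alpha_gt0 alpha_lt1 d bs il.
rewrite QE endpoints_translate in cQx cxQ.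
have inside y : `|y| < M + 2 -> (`]- e^-1, e^-1[%classic : set R) y.
  rewrite ltr_norml => /andP[y1 y2] /=; rewrite in_itv /=.
  by apply/andP; split; lra.
have /choice[y yP] k : exists y, (k <= n)%N ->
    endpoints S y /\ `|y + v - x k| < e.
  have [kn|nk] := leqP k n; last by exists 0.
  have [] := cxQ (x k).
    split; first exact: endpoints_chain.
    by apply: inside; apply: le_lt_trans (xM k kn) _; lra.
  move=> _ [z Sz <-]; rewrite /ball /= => h; exists z.
  by [].
have near z : endpoints S z -> `|z + v| < M + 2 ->
    exists2 k, (k <= n)%N & `|z + v - x k| < e.
  move=> Sz zM; have [] := cQx (z + v).
    by split; [exists z|exact: inside].
  move=> _ /chain_endpoints[k kn ->]; rewrite /ball /= distrC => h.
  by exists k.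
have ylt k : (k < n)%N -> y k < y k.+1.
  move=> kn; have [_ h1] := yP k (ltnW kn); have [_ h2] := yP k.+1 kn.
  have := xg k kn; move: h1 h2; rewrite !ltr_norml => /andP[h11 h12] /andP[h21
    h22].
  by lra.
have ytile k : (k < n)%N -> S (y k, y k.+1).
  move=> kn; have [Sy h1] := yP k (ltnW kn); have [Sy' h2] := yP k.+1 kn.
  have [U [SU Uy Uy']] := next_tile CS beta_gt0 lenS intS Sy Sy' (ylt k kn).
  move: Uy'; rewrite le_eqVlt => /orP[/eqP Uy'|Uy'].
    by rewrite -Uy -Uy' -surjective_pairing.
  (* An endpoint strictly in between is at distance at least [beta] from both matched neighbours,
     yet within [e < beta / 2] of some vertex of the chain. *)
  have [V [SV Vy Vy']] := next_tile CS beta_gt0 lenS intS (endpoints_snd SU)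
    Sy' Uy'.
  have lU := lenS _ SU; have lV := lenS _ SV.
  rewrite /tile_length Uy in lU; rewrite /tile_length Vy in lV.
  have xk := xM k (ltnW kn); have xk1 := xM k.+1 kn.
  move: h1 h2; rewrite !ltr_norml => /andP[h11 h12] /andP[h21 h22].
  move: xk xk1; rewrite !ler_norml => /andP[x11 x12] /andP[x21 x22].
  set z := U.2 in Uy' lU lV *; set w := V.2 in Vy' lV.
  have [|j jn] := near z (endpoints_snd SU).
    move: e01 elt h11 h22 x11 x22 Uy' lU beta_gt0; clear => *.
    by rewrite ltr_norml; apply/andP; split; lra.
  rewrite ltr_norml => /andP[j1 j2].
  have [jk|kj] := leqP j k.
    by have := xle _ _ jk (ltnW kn); lra.
  by have := xle _ _ kj jn; lra.
have /Fl [i0 i0l [yi0 _]] := SF _ (ytile 0%N n0).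
have yE k : (k <= n)%N -> (i0 + k <= size l)%N /\ y k = breakpoint u l (i0 + k).
  elim: k => [|k IH] kn; first by rewrite addn0 (ltnW i0l).
  have [ikl yk] := IH (ltnW kn).
  have /Fl [i il [yi yi']] := SF _ (ytile k kn).
  have iE : i = (i0 + k)%N.
    by apply: (breakpoint_inj d bs) => //; [exact: ltnW|rewrite -yi yk].
  by rewrite addnS -iE.
exists u, s, l, v, i0; split => //; first by have [] := yE n (leqnn n).
move=> k kn; have [_ <-] := yE k kn; have [_ h] := yP k kn.
by apply/ltW/(lt_le_trans h); lra.
Qed.
End Limit.

Section Chains.
Variable R : realType.
Implicit Types (x : nat -> R) (tau : set (R * R)).

Lemma patch_of_chain tau x n : tile_collection tau -> (0 < n)%N ->
  (forall k, (k < n)%N -> tau (x k, x k.+1)) -> patch_of (chain x n) tau.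
Proof.
move=> Ctau n0 xtau; have [Ttau triv] := Ctau.
have sub : chain x n `<=` tau by move=> _ [k /= kn <-]; exact: xtau.
have step k : (k < n)%N -> x k < x k.+1 by move=> kn;
  have := Ttau _ (xtau k kn).
have mono i j : (i <= j)%N -> (j <= n)%N -> x i <= x j.
  elim: j => [|j IH]; first by rewrite leqn0 => /eqP ->.
  rewrite leq_eqVlt => /orP[/eqP ->//|ij jn].
  by apply: le_trans (IH ij (ltnW jn)) _; exact/ltW/step.
split=> //; split.
- exact: finite_image (finite_II n).
- by split; [move=> T /sub /Ttau|move=> T U /sub tT /sub tU; exact: triv].
move=> a b [_ [i /= il <-]] + [_ [j /= jl <-]] + z /andP[az zb].
rewrite /tile_support /= !in_itv /= => /andP[ia _] /andP[_ bj].
have z0 : x 0%N <= z.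
  by apply: le_trans az; apply: le_trans ia; apply: mono => //; exact: ltnW.
have zn : z <= x n by apply: le_trans zb _; apply: le_trans bj _; exact: mono.
suff [k kn hk] : exists2 k, (k < n)%N & x k <= z <= x k.+1.
  by exists (x k, x k.+1); [exists k|rewrite /tile_support /= in_itv].
elim: n n0 zn {xtau sub step mono il jl} => // n IH _ zn.
have [h|h] := leP z (x n); last by exists n => //; rewrite ltW.
case: n IH zn h => [|n] IH zn h; first by exists 0%N => //; rewrite z0.
by have [k kn hk] := IH isT h; exists k => //; exact: ltnW.
Qed.

(** A single tile is a patch, so its ends are arbitrarily close to those of a translated tile of a
    subdivided interval. *)
Lemma tile_length_bounds (alpha : R) tau T : 0 < alpha -> alpha < 1 ->
  kakutani_tiling alpha tau -> tau T ->
  Num.min alpha (1 - alpha) <= tile_length T <= 1.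
Proof.
move=> a0 a1 [[Ctau _] lim] tT.
pose x k := if k is 0%N then T.1 else T.2.
have T12 : T.1 < T.2 by case: Ctau => h _; exact: h tT.
have ch : patch_of (chain x 1) tau.
  by apply: patch_of_chain => // -[|//] _; rewrite /x -surjective_pairing.
have g0 : 0 < tile_length T by rewrite subr_gt0.
have key e : 0 < e -> Num.min alpha (1 - alpha) - e <= tile_length T <= 1 + e.
  move=> e0; have e2 : 0 < e / 2 by rewrite divr_gt0.
  have [|u [s [l [v [i0 [d s1 il h]]]]]] :=
    limit_chain a0 a1 (isT : (0 < 1)%N) g0 e2 _ (lim _ ch).
    by move=> [|//] _; rewrite /x /tile_length addrC subrK.
  have bs : Num.min alpha (1 - alpha) <= s.
    by apply: le_trans s1; rewrite ge_min ltW.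
  rewrite addn1 in il.
  have /andP[h1 h2] := subdivided_tile_length a0 a1 d bs il.
  have := h 0%N isT; have := h 1%N isT; rewrite addn0 addn1 /x /tile_length.
  rewrite !ler_norml => /andP[h3 h4] /andP[h5 h6].
  by apply/andP; split; lra.
apply/andP; split; apply/ler_addgt0Pr => e /key /andP[h1 h2] //.
by rewrite -lerBlDr.
Qed.

End Chains.

(** * Transfer between chains of the tiling and subdivided intervals *)

Section Windows.
Variable R : realType.
Variables (alpha : R) (tau : set (R * R)) (x : int -> R).
Hypotheses (alpha_gt0 : 0 < alpha) (alpha_lt1 : alpha < 1).
Hypothesis tauK : kakutani_tiling alpha tau.
Hypothesis x_tau : forall k, tau (x k, x (k + 1)).
Let beta := Num.min alpha (1 - alpha).

Let beta_gt0 : 0 < beta.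
Proof. by rewrite lt_min alpha_gt0 subr_gt0. Qed.

Lemma enumeration_step k : beta <= x (k + 1) - x k <= 1.
Proof. exact: tile_length_bounds tauK (x_tau k). Qed.

Lemma enumeration_growth m (n : nat) :
  n%:R * beta <= x (m + n%:Z) - x m.
Proof.
elim: n => [|n IH]; first by rewrite mul0r addr0 subrr.
rewrite (_ : m + n.+1%:Z = m + n%:Z + 1); last by lia.
rewrite -natr1 mulrDl mul1r.
by have /andP[h _] := enumeration_step (m + n%:Z); lra.
Qed.

Lemma window_of_subdivided m (n : nat) : (0 < n)%N ->
  exists u s l v i0, [/\ subdivided alpha u s l, 1 <= s, (i0 + n <= size l)%N &
    forall k, (k <= n)%N ->
      `|breakpoint u l (i0 + k) + v - x (m + k%:Z)| <= 1].
Proof.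
move=> n0; have [[Ctau _] lim] := tauK.
have xS k : x (m + k.+1%:Z) = x (m + k%:Z + 1) by congr x; lia.
apply: (@limit_chain _ alpha alpha_gt0 alpha_lt1 (fun k => x (m + k%:Z)) n
  beta) => //.
- move=> k kn; rewrite xS.
  by have /andP[h _] := enumeration_step (m + k%:Z); lra.
- by apply/lim/patch_of_chain => // k kn; rewrite xS; exact: x_tau.
Qed.

Definition chain_deviation K c := forall m (n : nat),
  `|n%:R - c * (x (m + n%:Z) - x m)| <= K.

Lemma chain_deviation_evenly_spread K c : 0 < c -> chain_deviation K c ->
  forall S, exists u s l,
    [/\ S <= s, subdivided alpha u s l & evenly_spread (K + 2 * c) c u l].
Proof.
move=> c0 dev S.
(* Ensures that [beta / 2 * (n * beta - 2)] is at least [|S|]: the factor [beta / 2] is lost in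
   finding a supertile inside the run, and [2] by moving both ends by at most 1. *)
pose n := (Num.truncn (2 * (`|S| + 2 * beta) / beta ^+ 2)).+1.
have nS : 2 * (`|S| + 2 * beta) < n%:R * beta ^+ 2.
  by rewrite -ltr_pdivrMr ?exprn_gt0// truncnS_gt.
have [u [s [l [v [i0 [d s1 il h]]]]]] := @window_of_subdivided 0 n isT.
have good : small_deviation (K + 2 * c) c (breakpoint u l) i0 (i0 + n).
  move=> a b ia ab bn.
  rewrite -(subnKC ia) -(subnKC (leq_trans ia ab)) !natrD.
  have an : (a - i0 <= n)%N by rewrite leq_subLR (leq_trans ab).
  have bn' : (b - i0 <= n)%N by rewrite leq_subLR.
  have ab' : (a - i0 <= b - i0)%N by rewrite leq_sub2r.
  have ha := h _ an; have hb := h _ bn'.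
  move: ha hb ab'; set a' := (a - i0)%N; set b' := (b - i0)%N => ha hb ab'.
  have := dev (0 + a'%:Z) (b' - a')%N.
  rewrite (_ : 0 + a'%:Z + (b' - a')%N%:Z = 0 + b'%:Z); last by lia.
  rewrite natrB// => hd.
  set xa := x _ in ha hd; set xb := x _ in hb hd.
  set ya := breakpoint _ _ _ in ha *; set yb := breakpoint _ _ _ in hb *.
  have e1 : `|(yb + v - xb) - (ya + v - xa)| <= 2.
    by apply: le_trans (ler_normB _ _) _; lra.
  rewrite (_ : _ - _ = (b'%:R - a'%:R - c * (xb - xa)) -
    c * ((yb + v - xb) - (ya + v - xa))); last by ring.
  apply: le_trans (ler_normB _ _) _; rewrite normrM (gtr0_norm c0).
  by rewrite lerD// mulrC ler_pM2r.
have i0n : (i0 < i0 + n)%N by rewrite -[ltnLHS]addn0 ltn_add2l.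
have [u' [s' [l' [d' g' b']]]] :=
  subdivided_range alpha_gt0 alpha_lt1 d i0n il good.
exists u', s', l'; split => //; apply: le_trans b'.
have h0 := h 0%N isT; have hn := h n (leqnn n).
have gr := enumeration_growth 0 n.
move: h0 hn; rewrite addr0 addn0 !ler_norml => /andP[h01 h02] /andP[hn1 hn2].
set D := breakpoint u l _ - _.
have hD : n%:R * beta - 2 <= D by rewrite /D; lra.
apply: le_trans (ler_norm S) _.
have : beta / 2 * (n%:R * beta - 2) <= beta / 2 * D.
  by rewrite ler_pM2l// divr_gt0.
apply: le_trans.
rewrite (_ : _ * _ = (n%:R * beta ^+ 2) / 2 - beta); last by field.
by move: nS beta_gt0; lra.
Qed.

Lemma evenly_spread_windows K c1 : 
  (forall u s l, subdivided alpha u s l ->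
    exists c, 0 < c <= c1 /\ evenly_spread K c u l) ->
  forall m (n : nat), exists c, 0 < c /\
    forall i j : nat, (i <= j)%N -> (j <= n)%N ->
    `|j%:R - i%:R - c * (x (m + j%:Z) - x (m + i%:Z))| <= K + 2 * c1.
Proof.
move=> H m n.
have [u [s [l [v [i0 [d s1 il h]]]]]] := @window_of_subdivided m n.+1 isT.
have [c [/andP[c0 cc1] g]] := H _ _ _ d.
exists c; split => // i j ij jn.
have hj := h j (leq_trans jn (leqnSn n)).
have hi := h i (leq_trans (leq_trans ij jn) (leqnSn n)).
have := g (i0 + i)%N (i0 + j)%N isT.
rewrite leq_add2l => /(_ ij); rewrite !natrD => hg.
have {}hg : `|j%:R - i%:R - c * (breakpoint u l (i0 + j) - breakpoint u l (i0 +
  i))| <= K.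
  rewrite (_ : j%:R - i%:R = i0%:R + j%:R - (i0%:R + i%:R)); last by ring.
  apply: hg; apply: leq_trans il; rewrite leq_add2l;
    exact: leq_trans jn (leqnSn n).
set xi := x _ in hi *; set xj := x _ in hj *.
set yi := breakpoint _ _ _ in hi hg; set yj := breakpoint _ _ _ in hj hg.
have e1 : `|(yj + v - xj) - (yi + v - xi)| <= 2.
  by apply: le_trans (ler_normB _ _) _; lra.
rewrite (_ : _ - _ = (j%:R - i%:R - c * (yj - yi)) +
  c * ((yj + v - xj) - (yi + v - xi))); last by ring.
apply: le_trans (ler_normD _ _) _; rewrite normrM (gtr0_norm c0).
rewrite lerD//; apply: le_trans (_ : c * 2 <= _); first by rewrite ler_pM2l.
by rewrite mulrC ler_pM2l.
Qed.

(* The density is squeezed between [(n - K) / len] and [(n + K) / len] over all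
   finite chains, any two of which lie in a common window. *)
Lemma windows_density K :
  (forall m (n : nat), exists c, 0 < c /\
    forall i j : nat, (i <= j)%N -> (j <= n)%N ->
    `|j%:R - i%:R - c * (x (m + j%:Z) - x (m + i%:Z))| <= K) ->
  exists2 c, 0 < c & chain_deviation K c.
Proof.
move=> H.
pose D m (n : nat) := x (m + n%:Z) - x m.
have D0 m n : (0 < n)%N -> 0 < D m n.
  move=> n0; apply: lt_le_trans (enumeration_growth m n).
  by rewrite mulr_gt0// ltr0n.
have K0 : 0 <= K.
  by have [c [_ /(_ 0%N 0%N isT isT)]] := H 0 0%N; apply: le_trans.
have common m n m' n' : exists c, 0 < c /\
    (`|n%:R - c * D m n| <= K /\ `|n'%:R - c * D m' n'| <= K).
  pose m0 := Num.min m m'.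
  have [c [c0 hc]] := H m0 (`|m - m0| + n + (`|m' - m0| + n'))%N.
  have sub k r : m0 <= k -> (`|k - m0| + r <= `|m - m0| + n + (`|m' - m0| +
    n'))%N ->
      `|r%:R - c * D k r| <= K.
    move=> mk kr; have := hc `|k - m0|%N (`|k - m0| + r)%N (leq_addr _ _) kr.
    rewrite natrD [_ + r%:R]addrC addrK.
    rewrite (_ : m0 + (`|k - m0| + r)%N%:Z = k + r%:Z); last by lia.
    by rewrite (_ : m0 + `|k - m0|%N%:Z = k)//; lia.
  exists c; split => //; split; apply: sub.
  - by rewrite ge_min lexx.
  - by rewrite leq_addr.
  - by rewrite ge_min lexx orbT.
  - by rewrite leq_addl.
pose A : set R := [set y | exists m (n : nat), (0 < n)%N /\ y = (n%:R - K) / D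
  m n].
have Aub m n : (0 < n)%N -> ubound A ((n%:R + K) / D m n).
  move=> n0 _ [m' [n' [n'0 ->]]].
  have [c [c0 [h1 h2]]] := common m n m' n'.
  move: h1 h2; rewrite !ler_norml => /andP[h1 _] /andP[_ h2].
  apply: (@le_trans _ _ c); first by rewrite ler_pdivrMr ?D0//; lra.
  by rewrite ler_pdivlMr ?D0//; lra.
have supA : has_sup A.
  split; first by exists ((1%:R - K) / D 0 1), 0, 1%N.
  by exists ((1%:R + K) / D 0 1%N); exact: Aub.
exists (sup A).
  pose n := (Num.truncn K).+1.
  have nK : K < n%:R by exact: truncnS_gt.
  apply: (@lt_le_trans _ _ ((n%:R - K) / D 0 n)).
    by rewrite divr_gt0 ?D0//; lra.
  by apply: sup_upper_bound => //; exists 0, n.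
move=> m n; have [->|n0] := posnP n.
  by rewrite addr0 subrr mulr0 subrr normr0.
have h1 : (n%:R - K) / D m n <= sup A.
  by apply: sup_upper_bound => //; exists m, n.
have h2 : sup A <= (n%:R + K) / D m n by apply: ge_sup; [case: supA|exact: Aub].
rewrite ler_pdivrMr ?D0// in h1; rewrite ler_pdivlMr ?D0// in h2.
by rewrite -/(D m n) ler_norml; apply/andP; split; lra.
Qed.

End Windows.

(** * Bounded displacement *)

Section BoundedDisplacement.
Variable R : realType.
Implicit Types (a b c K : R).

Lemma int_count_le (h : nat -> int) (r : nat) a b : (0 < r)%N ->
  (forall i j, (i < r)%N -> (j < r)%N -> h i = h j -> i = j) ->
  (forall i, (i < r)%N -> a <= (h i)%:~R <= b) -> r%:R <= b - a + 2.
Proof.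
move=> r0 inj ab.
set m := Num.floor a; set M := Num.floor b.
have hm i : (i < r)%N -> m <= h i.
  by move=> ir; have /andP[h1 _] := ab _ ir; rewrite -(ler_int R) (le_trans
    (floor_le _)).
have hM i : (i < r)%N -> h i <= M.
  by move=> ir; have /andP[_ h2] := ab _ ir; rewrite floor_ge_int.
have mM : m <= M := le_trans (hm _ r0) (hM _ r0).
have : (size (map (fun i => `|h i - m|%N) (iota 0 r)) <= size (iota 0 `|M -
  m|.+1))%N.
  apply: uniq_leq_size.
    rewrite map_inj_in_uniq ?iota_uniq// => i j.
    rewrite !mem_iota /= !add0n => ir jr e; apply: inj => //.
    by have := hm _ ir; have := hm _ jr; move: e; lia.
  move=> _ /mapP[i + ->]; rewrite !mem_iota /= !add0n => ir.
  by have := hm _ ir; have := hM _ ir; lia.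
rewrite size_map !size_iota -(ler_nat R) => /le_trans; apply.
have : (`|M - m|%N%:R : R) = M%:~R - m%:~R.
  by rewrite -intrB -[in RHS](gez0_abs (_ : 0 <= M - m)) ?subr_ge0.
rewrite -natr1 => ->.
have := floor_le b; have := floorD1_gt a; rewrite -/m -/M intrD1.
by lra.
Qed.

Variables (tau : set (R * R)) (x : int -> R) (L : set R) (p : R * R -> R) (beta
  : R).
Hypotheses (beta_gt0 : 0 < beta).
Hypothesis x_tau : forall k, tau (x k, x (k + 1)).
Hypothesis tau_x : forall T, tau T -> exists k, T = (x k, x (k + 1)).
Hypothesis x_step : forall k, beta <= x (k + 1) - x k <= 1.
Hypothesis p_support : forall T, tau T -> tile_support T (p T).
Hypothesis p_inj : set_inj tau p.
Hypothesis L_eq : L = p @` tau.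

Let pt k := p (x k, x (k + 1)).

Let pt_near k : `|pt k - x k| <= 1.
Proof.
have := p_support (x_tau k); rewrite /tile_support /= in_itv /= -/(pt k).
have /andP[_ h] := x_step k.
by move=> /andP[h1 h2]; rewrite ler_norml; apply/andP; split; lra.
Qed.

Let x_lt k l : k < l -> x k < x l.
Proof.
move=> kl; rewrite (_ : l = k + `|l - k|.-1.+1%:Z); last by lia.
elim: (_.-1) => [|n IH].
  by have /andP[h _] := x_step k; move: beta_gt0; lra.
rewrite (_ : k + n.+2%:Z = k + n.+1%:Z + 1); last by lia.
by have /andP[h _] := x_step (k + n.+1%:Z); move: beta_gt0; lra.
Qed.

Let x_inj k l : x k = x l -> k = l.
Proof. by move=> e; case: (ltgtP k l) => // /x_lt; rewrite e ltxx. Qed.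

Let pt_inj k l : pt k = pt l -> k = l.
Proof.
move=> e; apply: x_inj.
by have [] := p_inj (mem_set (x_tau k)) (mem_set (x_tau l)) e.
Qed.

Let pt_L k : L (pt k). Proof. by rewrite L_eq; exists (x k, x (k + 1)). Qed.

Let L_pt y : L y -> exists k, y = pt k.
Proof. by rewrite L_eq => -[T /[dup] tT /tau_x[k ->] <-]; exists k. Qed.

(** The bijection need not be monotone, so counting goes both ways. Injectivity bounds [n] by the
    number of integers near the scaled chain; by surjectivity every integer well inside it comes
    from an index between [m] and [m + n]. *)
Lemma bd_equivalent_chain_deviation c0 : 0 < c0 -> bd_equivalent L (lattice c0)
  ->
  exists K, chain_deviation x K c0^-1.
Proof.
move=> c00 [phi [phi_fun phi_inj phi_surj] [M0 M0ub]].
have phiM y : L y -> `|y - phi y| <= M0 by move=> Ly; apply: M0ub; exists y.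
have /choice[pi piP] k : exists j : int, phi (pt k) = c0 * j%:~R.
  by have [j _ <-] := phi_fun _ (pt_L k); exists j.
have pi_inj k l : pi k = pi l -> k = l.
  move=> e; apply: pt_inj; apply: phi_inj; rewrite ?inE ?piP ?e//; exact: pt_L.
have pi_surj j : exists k, pi k = j.
  have [|y /L_pt[k ->] h] := phi_surj (c0 * j%:~R); first by exists j.
  exists k; move: h; rewrite piP => /(mulfI (lt0r_neq0 c00)) /eqP.
  by rewrite eqr_int => /eqP.
pose M := M0 + 1.
have near k : `|x k - c0 * (pi k)%:~R| <= M.
  rewrite -piP (_ : _ - _ = (pt k - phi (pt k)) - (pt k - x k)); last by ring.
  by apply: le_trans (ler_normB _ _) _; rewrite lerD ?phiM.
have M_ge0 : 0 <= M by apply: le_trans (near 0).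
have nearV k : x k / c0 - M / c0 <= (pi k)%:~R <= x k / c0 + M / c0.
  have := near k; rewrite ler_norml => /andP[h1 h2].
  by rewrite -mulrBl -mulrDl ler_pdivrMr// ler_pdivlMr//; apply/andP; split;
    lra.
have x_le k l : k <= l -> x k <= x l.
  by rewrite le_eqVlt => /orP[/eqP ->//|/x_lt/ltW].
exists (2 * (M / c0) + 4) => m n.
have MV : 0 <= M / c0 by rewrite divr_ge0// ltW.
rewrite mulrBr ![c0^-1 * _]mulrC.
have [->|n0] := posnP n.
  by rewrite addr0 subrr subrr normr0; lra.
have up : n%:R <= (x (m + n%:Z) / c0 + M / c0) - (x m / c0 - M / c0) + 2.
  apply: (@int_count_le (fun i => pi (m + i%:Z))) => //.
    by move=> i j _ _ /pi_inj; lia.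
  move=> i i_n; have /andP[h1 h2] := nearV (m + i%:Z).
  have xm : x m / c0 <= x (m + i%:Z) / c0 by rewrite ler_pM2r
    ?invr_gt0// x_le//; lia.
  have xn : x (m + i%:Z) / c0 <= x (m + n%:Z) / c0.
    by rewrite ler_pM2r ?invr_gt0// x_le//; lia.
  by apply/andP; split; lra.
have dn : x (m + n%:Z) / c0 - x m / c0 - 2 * (M / c0) - 2 <= n%:R + 2.
  (* The scaled chain is shortened by [M / c0] at both ends, so that preimages stay in the chain;
     the last unit in [d] pays for rounding [a] up to an integer. *)
  set a := x m / c0 + M / c0.
  set d := x (m + n%:Z) / c0 - M / c0 - a - 1.
  have n_ge0 : 0 <= n%:R :> R by rewrite ler0n.
  have [d1|d1] := ltP d 1; first by rewrite /d /a in d1; lra.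
  pose r := Num.truncn d.
  have r0 : (0 < r)%N by rewrite /r truncn_gt0.
  have rd : r%:R <= d by rewrite truncn_le; lra.
  have dr : d < r%:R + 1 by rewrite natr1; exact: truncnS_gt.
  have [j0 j01 j02] : exists2 j0 : int, a < j0%:~R & j0%:~R <= a + 1.
    exists (Num.floor a + 1); first exact: floorD1_gt.
    by rewrite intrD lerD2r floor_le.
  have /choice[k kP] i : exists k, pi k = j0 + i%:Z by exact: pi_surj.
  have kin i : (i < r)%N -> m <= k i <= m + n%:Z.
    move=> ir; have /andP[h1 h2] := nearV (k i).
    have jE : (pi (k i))%:~R = j0%:~R + i%:R :> R by rewrite kP intrD.
    rewrite jE in h1 h2.
    have i0 : 0 <= i%:R :> R by rewrite ler0n.
    have ir' : i%:R + 1 <= r%:R :> R by rewrite natr1 ler_nat.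
    have lo : x m / c0 < x (k i) / c0 by rewrite /a in j01; lra.
    have hi : x (k i) / c0 < x (m + n%:Z) / c0 by rewrite /d in rd; lra.
    rewrite ltr_pM2r ?invr_gt0// in lo; rewrite ltr_pM2r ?invr_gt0// in hi.
    apply/andP; split; rewrite leNgt; apply/negP => /x_lt.
      by move=> /(lt_trans lo); rewrite ltxx.
    by move=> /(lt_trans hi); rewrite ltxx.
  have : r%:R <= (m + n%:Z)%:~R - m%:~R + 2 :> R.
    apply: (@int_count_le k) => //.
      by move=> i j _ _ e; have := kP i; rewrite e kP => /addrI [->].
    by move=> i ir; rewrite !ler_int; exact: kin.
  rewrite intrD (_ : (n%:Z)%:~R = n%:R :> R)// => h.
  by rewrite /d /a in dr; lra.
by rewrite ler_norml; apply/andP; split; lra.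
Qed.

Lemma chain_deviation_bd_equivalent K c : 0 < c -> chain_deviation x K c ->
  bd_equivalent L (lattice c^-1).
Proof.
move=> c0 dev.
have /choice[idx idxP] y : exists k, L y -> y = pt k.
  have [/L_pt[k h]|nL] := pselect (L y); first by exists k.
  by exists 0.
exists (fun y => c^-1 * (idx y)%:~R).
  split.
  - by move=> y Ly; exists (idx y).
  - move=> y z; rewrite !inE => Ly Lz.
    move=> /(mulfI (invr_neq0 (lt0r_neq0 c0))) /eqP; rewrite eqr_int => /eqP e.
    by rewrite (idxP y Ly) (idxP z Lz) e.
  - move=> _ [k _ <-]; exists (pt k) => //=.
    by congr (_ * _%:~R); apply: pt_inj; rewrite -idxP.
exists (`|x 0| + K / c + 1) => _ [y Ly <-].
set k := idx y; rewrite (idxP y Ly) -/k.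
have hk : `|k%:~R - c * (x k - x 0)| <= K.
  have [k0|k0] := leP 0 k.
    have := dev 0 `|k|%N; rewrite add0r gez0_abs//.
    by rewrite -[X in X - _](_ : k%:~R = _)// -[in LHS](gez0_abs k0).
  have := dev k `|k|%N; rewrite (_ : k + `|k|%N%:Z = 0); last by lia.
  rewrite -normrN (_ : - _ = k%:~R - c * (x k - x 0))//.
  have -> : `|k|%N%:R = - k%:~R :> R by rewrite -mulrNz -ltz0_abs.
  by ring.
have -> : pt k - c^-1 * k%:~R =
    (pt k - x k) + x 0 - c^-1 * (k%:~R - c * (x k - x 0)).
  by field; rewrite gt_eqF.
apply: le_trans (ler_normB _ _) _.
rewrite normrM (gtr0_norm (_ : 0 < c^-1)) ?invr_gt0//.
have h1 : c^-1 * `|k%:~R - c * (x k - x 0)| <= K / c.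
  by rewrite mulrC ler_pM2r ?invr_gt0.
apply: le_trans (lerD (ler_normD _ _) h1) _.
by have := pt_near k; lra.
Qed.

Lemma tiling_relatively_dense : is_tiling tau -> relatively_dense L.
Proof.
move=> [_ cov]; exists 3 => // y.
have : [set: R] y by [].
rewrite -cov => -[T tT]; have [k TE] := tau_x tT; rewrite TE.
rewrite /tile_support /= in_itv /= => /andP[h1 h2].
exists (pt k); split => //; rewrite /ball /=.
have /andP[_ h3] := x_step k.
have := pt_near k; rewrite ler_norml => /andP[h4 h5].
by rewrite ltr_norml; apply/andP; split; lra.
Qed.

End BoundedDisplacement.

Section LogRatio.
Variable R : realType.
Implicit Types (alpha x : R).

Lemma log_ratio_commensurable alpha x p q : 0 < x < 1 ->
  alpha = x ^+ p -> 1 - alpha = x ^+ q ->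
  log_ratio alpha = (maxn p q)%:R / (minn p q)%:R.
Proof.
move=> /andP[x0 x1] aE caE.
have lnx : ln x != 0 by rewrite lt_eqF// ln_lt0// x0.
have key i j : ln (x ^+ i) / ln (x ^+ j) = i%:R / j%:R.
  by rewrite !lnXn// -(mulr_natl (ln x) i) -(mulr_natl (ln x) j) -mulf_div
    mulfV ?mulr1.
rewrite /log_ratio; have [pq|qp] := leqP p q.
  have -> : Num.min alpha (1 - alpha) = x ^+ q.
    by rewrite caE aE min_r// ler_wiXn2l ?(ltW x0) ?(ltW x1).
  by rewrite (_ : 1 - x ^+ q = x ^+ p) ?key// -caE subKr aE.
have -> : Num.min alpha (1 - alpha) = x ^+ p.
  by rewrite caE aE min_l// ler_wiXn2l ?(ltW x0) ?(ltW x1) ?(ltnW qp).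
by rewrite -aE caE aE key.
Qed.

Lemma log_ratio_power alpha (p q : nat) : 0 < alpha < 1 -> (0 < q)%N ->
  log_ratio alpha = p%:R / q%:R ->
  exists2 x, 0 < x < 1 & alpha = x ^+ p /\ 1 - alpha = x ^+ q \/
                         alpha = x ^+ q /\ 1 - alpha = x ^+ p.
Proof.
move=> /andP[a0 a1] q0; rewrite /log_ratio.
set m := Num.min _ _ => lr.
have m0 : 0 < m by rewrite lt_min a0 subr_gt0.
have m1 : m < 1 by rewrite gt_min a1.
have cm0 : 0 < 1 - m by rewrite subr_gt0.
have cm1 : 1 - m < 1 by rewrite gtrBl.
have lncm : ln (1 - m) < 0 by rewrite ln_lt0// cm0.
have qR : 0 < q%:R :> R by rewrite ltr0n.
pose x := expR (ln (1 - m) / q%:R).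
have x01 : 0 < x < 1 by rewrite expR_gt0 expR_lt1 pmulr_llt0 ?invr_gt0.
have xq : 1 - m = x ^+ q.
  by rewrite /x -expRM_natl mulrC divfK ?gt_eqF// lnK.
have xp : m = x ^+ p.
  rewrite /x -expRM_natl mulrA mulrAC -lr divfK ?lt_eqF// lnK//.
have [am|am] : m = alpha \/ m = 1 - alpha.
- by rewrite /m; case: leP; [left|right].
- by exists x => //; left; rewrite -am.
- exists x => //; right; rewrite -am; split => //.
  by rewrite -xq am subKr.
Qed.

End LogRatio.

Theorem theorem1p1 (R : realType) (alpha : R) (alpha_gt0 : 0 < alpha)
    (alpha_lt1 : alpha < 1) (tau : set (R * R))
    (tauK : kakutani_tiling alpha tau) (L : set R)
    (Ltau : associated_with tau L) :
  uniformly_spread L <-> log_ratio alpha \in [:: 1; 3 / 2; 2; 3; 4].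
Proof.
have [p [p_support p_inj L_eq L_ud]] := Ltau.
pose beta := Num.min alpha (1 - alpha).
have beta_gt0 : 0 < beta by rewrite lt_min alpha_gt0 subr_gt0.
have [tauT _] := tauK.
have len_tau T : tau T -> beta <= tile_length T.
  by move=> /(tile_length_bounds alpha_gt0 alpha_lt1 tauK) /andP[].
have [x [x_tau tau_x]] := tiling_enumeration tauT beta_gt0 len_tau.
have x_step := enumeration_step alpha_gt0 alpha_lt1 tauK x_tau.
have ca0 : 0 < 1 - alpha by rewrite subr_gt0.
have ca1 : 1 - alpha < 1 by rewrite gtrBl.
split=> [[_ [c c0 bd]]|lr].
  have [K dev] := bd_equivalent_chain_deviation beta_gt0 x_tau tau_x x_step
    p_support p_inj L_eq c0 bd.
  have cV0 : 0 < c^-1 by rewrite invr_gt0.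
  have H := chain_deviation_evenly_spread alpha_gt0 alpha_lt1 tauK x_tau cV0
    dev.
  have [inc|[z [i [j [z01 i0 j0 cop [aE caE]]]]]] :=
    @commensurability R alpha (1 - alpha) (introT andP (conj alpha_gt0
      alpha_lt1))
      (introT andP (conj ca0 ca1)).
    by have := incommensurable_not_evenly_spread alpha_gt0 alpha_lt1 cV0 inc H.
  have /andP[z0 z1] := z01.
  have ij6 : (i + j <= 6)%N.
    rewrite leqNgt; apply/negP => ij.
    exact: (commensurable_not_evenly_spread z0 z1 i0 j0 aE caE cop ij H).
  have n51 : ~ (alpha = z /\ 1 - alpha = z ^+ 5 \/ alpha = z ^+ 5 /\ 1 - alpha
    = z).
    by move=> h; exact: (commensurable51_not_evenly_spread z0 z1 h H).
  rewrite (log_ratio_commensurable z01 aE caE) !inE.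
  have i6 : (i < 6)%N by move: j0 ij6; clear; lia.
  have j6 : (j < 6)%N by move: i0 ij6; clear; lia.
  (* Coprime pairs of sum at most 6: all give a listed ratio except 5 and 1 in either order, which
     [n51] excludes. *)
  move: i j i6 j6 i0 j0 cop ij6 aE caE.
  case=> [|[|[|[|[|[|//]]]]]]; case=> [|[|[|[|[|[|//]]]]]]
    //= _ _ _ _ _ _ aE caE;
    rewrite /maxn /minn /= ?divr1 ?eqxx ?orbT//.
  - by case: n51; left.
  - by case: n51; right.
split; first by split =>
  //; exact: (tiling_relatively_dense x_tau tau_x x_step p_support).
have [z [i [j [z01 i0 j0 [aE caE] dd]]]] : exists (z : R) (i j : nat),
    [/\ 0 < z < 1, (0 < i)%N, (0 < j)%N, alpha = z ^+ i /\ 1 - alpha = z ^+ j &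
      decaying_deviation z (level_count i j)].
  have good k l : (0 < k)%N -> (0 < l)%N -> log_ratio alpha = k%:R / l%:R ->
     (forall z : R, 0 < z < 1 -> z ^+ k + z ^+ l = 1 -> 
        decaying_deviation z (level_count k l)) ->
     exists (z : R) (i j : nat),
    [/\ 0 < z < 1, (0 < i)%N, (0 < j)%N, alpha = z ^+ i /\ 1 - alpha = z ^+ j &
      decaying_deviation z (level_count i j)].
    move=> k0 l0 lrE dd.
    have [|z z01 [[aE caE]|[aE caE]]] := log_ratio_power _ l0 lrE.
    - by rewrite alpha_gt0.
    - exists z, k, l; split => //; apply: dd => //.
      by rewrite -aE -caE addrC subrK.
    - exists z, l, k; split => //.
      rewrite (_ : level_count l k = level_count k l); last first.
        by apply/funext => r; exact: level_countC.
      by apply: dd => //; rewrite -aE -caE subrK.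
  move: lr; rewrite !inE => /or4P[/eqP lrE|/eqP lrE|/eqP lrE|/orP[/eqP lrE|/eqP
    lrE]].
  - apply: (good 1%N 1%N) => //; first by rewrite lrE divr1.
    by move=> z _; exact: level_count_deviation11.
  - by apply: (good 3%N 2%N) => // z; exact: level_count_deviation32.
  - apply: (good 2%N 1%N) => //; first by rewrite lrE divr1.
    by move=> z; rewrite expr1; exact: level_count_deviation21.
  - apply: (good 3%N 1%N) => //; first by rewrite lrE divr1.
    by move=> z; rewrite expr1; exact: level_count_deviation31.
  - apply: (good 4%N 1%N) => //; first by rewrite lrE divr1.
    by move=> z; rewrite expr1; exact: level_count_deviation41.
have /andP[z0 z1] := z01.
have [K [c1 unif]] := decaying_deviation_evenly_spread z0 z1 i0 j0 aE caE dd.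
have win := evenly_spread_windows alpha_gt0 alpha_lt1 tauK x_tau unif.
have [c c0 dev] := windows_density alpha_gt0 alpha_lt1 tauK x_tau win.
exists c^-1; first by rewrite invr_gt0.
exact: (chain_deviation_bd_equivalent beta_gt0 x_tau tau_x x_step p_support
  p_inj L_eq c0 dev).
Qed.
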